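(* Let $\varepsilon>0$ and let $k\ge1$ be an integer. Let $\mathcal{M}_{\mathrm{BR}}^k$ be the class of nonadaptive compositions of $k$ $\varepsilon$-bounded-range mechanisms, and let $\mathcal{A}_{\mathrm{BR}}^k$ be the family of adaptive composition games, over all adversaries, in which an $\varepsilon$-bounded-range mechanism is selected in each of $k$ rounds. (1) If $k\ge 4$, then for every $\varepsilon_g\in[0,(k-3)\varepsilon]$, $$\delta_{\mathrm{opt}}(\mathcal{A}_{\mathrm{BR}}^k,\varepsilon_g)>\delta_{\mathrm{opt}}(\mathcal{M}_{\mathrm{BR}}^k,\varepsilon_g).$$ (2) For every $\varepsilon_g\ge (k-1)\varepsilon$, $$\delta_{\mathrm{opt}}(\mathcal{A}_{\mathrm{BR}}^k,\varepsilon_g)=\delta_{\mathrm{opt}}(\mathcal{M}_{\mathrm{BR}}^k,\varepsilon_g).$$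
   Context: A data universe is a set $\mathcal{X}$ with a symmetric neighboring relation $x\sim x'$. A mechanism $M:\mathcal{X}\to\mathcal{Y}$ assigns to each $x$ a probability distribution of a random outcome $M(x)\in\mathcal{Y}$; $\Pr[M(x)=y]$ denotes the probability mass function, or, for continuous outcome spaces, the probability density function with respect to a common reference measure. $M$ is $\varepsilon$-bounded-range ($\varepsilon$-BR) if for all neighbors $x\sim x'$ and all $y_1,y_2\in\mathcal{Y}$, $\frac{\Pr[M(x)=y_1]}{\Pr[M(x')=y_1]}\le e^{\varepsilon}\frac{\Pr[M(x)=y_2]}{\Pr[M(x')=y_2]}$ (in cross-multiplied form when probabilities vanish). $M$ is $(\varepsilon,\delta)$-DP if $\Pr[M(x)\in S]\le e^{\varepsilon}\Pr[M(x')\in S]+\delta$ for all $x\sim x'$ and all (measurable) $S\subseteq\mathcal{Y}$. For $\varepsilon_g\in\mathbb{R}$, $\delta_{\mathrm{opt}}(M,\varepsilon_g)=\inf\{\delta: M\text{ is }(\varepsilon_g,\delta)\text{-DP}\}$, and for a class $\mathcal{M}$, $\delta_{\mathrm{opt}}(\mathcal{M},\varepsilon_g)=\sup_{M\in\mathcal{M}}\delta_{\mathrm{opt}}(M,\varepsilon_g)$. Nonadaptive class: $\mathcal{M}_{\mathrm{BR}}^k=\{M_1\times\cdots\times M_k: \text{each } M_i\text{ is }\varepsilon\text{-BR}\}$, where $M_1\times\cdots\times M_k$ maps $x$ to $(M_1(x),\dots,M_k(x))$ with independent draws; data universe (with at least one neighboring pair) and outcome spaces are arbitrary. Adaptive composition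 game: an adversary is a pair $\mathcal{A}=(\mathcal{R},\mathcal{D})$ with $\mathcal{R}$ a randomized algorithm and $\mathcal{D}$ a deterministic one. Given classes of mechanisms $(\mathcal{E}_1,\dots,\mathcal{E}_k)$ and a bit $b\in\{0,1\}$, the game $\mathrm{AdaComp}(\mathcal{A},(\mathcal{E}_1,\dots,\mathcal{E}_k),b)$ runs: draw $r_0\sim\mathcal{R}(\emptyset)$; for $i=1,\dots,k$: $\mathcal{D}(r_0,A_1^b,r_1,\dots,A_{i-1}^b,r_{i-1})$ selects neighboring datasets $x^{i,0}\sim x^{i,1}$ and a mechanism $M_i\in\mathcal{E}_i$, the outcome $A_i^b=M_i(x^{i,b})$ is drawn with fresh randomness, and $r_i\sim\mathcal{R}(r_0,A_1^b,\dots,r_{i-1},A_i^b)$. The output is the view $(r_0,A_1^b,r_1,\dots,A_k^b,r_k)$. For a fixed adversary this is regarded as a mechanism with input $b\in\{0,1\}$, the inputs $0$ and $1$ being neighbors. With $\mathcal{E}_i$ the class of all $\varepsilon$-BR mechanisms for every $i$, $\mathcal{A}_{\mathrm{BR}}^k=\{\mathrm{AdaComp}(\mathcal{A},(\mathcal{E}_1,\dots,\mathcal{E}_k),\cdot):\mathcal{A}\text{ an adversary}\}$. *)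

(* Defs.v *)
From HB Require Import structures.
From mathcomp Require Import all_boot all_order all_algebra.
From mathcomp Require Import all_classical all_reals all_analysis.

Set Implicit Arguments.
Unset Strict Implicit.
Unset Printing Implicit Defensive.

Import Order.TTheory GRing.Theory Num.Theory.
Import numFieldNormedType.Exports.

Local Open Scope classical_set_scope.
Local Open Scope ring_scope.

Section semidirect_product.
Local Open Scope ereal_scope.
Context d1 d2 (T1 : measurableType d1) (T2 : measurableType d2)
  (R : realType) (P : probability T1 R) (K : R.-pker T1 ~> T2).

(* The joint law of (x, y) when x is drawn from P and then y from K x. When K
   is constant this unfolds to the library's product measure. *)
Definition semidirect (A : set (T1 * T2)) : \bar R :=
  \int[P]_x K x (xsection A x).

Let semidirect0 : semidirect set0 = 0.
Proof. by apply: integral0_eq => x _; rewrite xsection0 measure0. Qed.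

Let semidirect_ge0 A : 0 <= semidirect A.
Proof. exact: integral_ge0. Qed.

Let semidirect_sigma_additive : semi_sigma_additive semidirect.
Proof.
move=> F mF tF mUF.
rewrite [X in _ --> X](_ : _ = \sum_(n <oo) semidirect (F n)).
  by apply/cvg_closeP; split; [exact: is_cvg_nneseries|rewrite closeE].
rewrite -integral_nneseries//; last first.
  by move=> n; apply: (measurable_fun_xsection_finite_kernel K); rewrite inE.
apply: eq_integral => x _; apply/esym/cvg_lim => //=; rewrite xsection_bigcup.
apply: (measure_sigma_additive _ (trivIset_xsection tF)) => ?.
exact: measurable_xsection.
Qed.

HB.instance Definition _ := isMeasure.Build _ _ R semidirect
  semidirect0 semidirect_ge0 semidirect_sigma_additive.

Let semidirect_setT : semidirect setT = 1.
Proof.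
rewrite /semidirect -(probability_setT P) -[RHS]mul1e -integral_cst //.
by apply: eq_integral => x _; rewrite -setXTT in_xsectionX ?inE//; exact: prob_kernel.
Qed.

HB.instance Definition _ := Measure_isProbability.Build _ _ _ semidirect
  semidirect_setT.

End semidirect_product.

Record universe := Universe {
  dataset : Type ;
  neighbor : dataset -> dataset -> Prop ;
  neighbor_sym : forall x x', neighbor x x' -> neighbor x' x }.

Section mechanisms.
Context (R : realType).

Record mechanism (U : universe) := Mechanism {
  outcome_display : measure_display ;
  outcome : measurableType outcome_display ;
  law : dataset U -> probability outcome R }.

Definition mechanism_class := forall U : universe, mechanism U -> Prop.

(* Probability mass functions are densities with respect to the counting
   measure. A density is determined by the laws only up to the choice of the
   reference measure and null sets, so some version of it has to satisfy the
   inequality everywhere; point masses are unaffected by this choice. *)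
Definition bounded_range (eps : R) : mechanism_class := fun U M =>
  exists (mu : {measure set (outcome M) -> \bar R})
         (p : dataset U -> outcome M -> R),
    [/\ forall x, measurable_fun [set: outcome M] (p x),
        forall x y, 0 <= p x y,
        forall x S, measurable S ->
          law M x S = (\int[mu]_(y in S) (p x y)%:E)%E
      & forall x x', neighbor x x' -> forall y1 y2,
          p x y1 * p x' y2 <= expR eps * (p x y2 * p x' y1)].

Definition dp U (M : mechanism U) (eps delta : R) : Prop :=
  forall x x', neighbor x x' -> forall S, measurable S ->
    (law M x S <= (expR eps)%:E * law M x' S + delta%:E)%E.

Definition delta_opt U (M : mechanism U) (eps_g : R) : \bar R :=
  ereal_inf [set delta%:E | delta in [set delta | dp M eps_g delta]].

Definition delta_opt_class (C : mechanism_class) (eps_g : R) : \bar R :=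
  ereal_sup
    [set e | exists U (M : mechanism U), C U M /\ e = delta_opt M eps_g].

Definition mechanism_prod U (M N : mechanism U) : mechanism U :=
  Mechanism (fun x => (law M x \x law N x)%E : probability _ R).

Definition mechanism_unit U : mechanism U :=
  Mechanism (fun=> \d_tt : probability unit R).

(* The k-fold product M_1 x (M_2 x ... (M_k x unit)). *)
Variant nonadaptive_br (eps : R) (k : nat) : mechanism_class :=
  NonadaptiveBR (U : universe) (M : 'I_k -> mechanism U) of
      (exists x x' : dataset U, neighbor x x')
    & (forall i, bounded_range eps (M i))
  : nonadaptive_br eps k (\big[@mechanism_prod U/mechanism_unit U]_(i < k) M i).

Record selection (E : mechanism_class) d (Y : measurableType d) := Selection {
  sel_universe : universe ;
  sel_data : bool -> dataset sel_universe ;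
  sel_neighbor : neighbor (sel_data false) (sel_data true) ;
  sel_law : dataset sel_universe -> probability Y R ;
  sel_class : E sel_universe (Mechanism sel_law) }.

Section history.
Context (dY dZ : nat -> measure_display).
Context (Y : forall i, measurableType (dY i))
  (Z : forall i, measurableType (dZ i)).

Fixpoint history_display (i : nat) : measure_display :=
  if i is j.+1
  then measure_prod_display
         (measure_prod_display (history_display j, dY j), dZ j.+1)
  else dZ 0.

(* history i is the space of (r_0, A_1, r_1, ..., A_i, r_i), with r_j in Z j and
   A_(j+1) in Y j. *)
Fixpoint history (i : nat) : measurableType (history_display i) :=
  if i is j.+1 then (history j * Y j * Z j.+1)%type else Z 0.

End history.

(* Rounds are numbered from 0. The outcome space of a round is fixed; an
   outcome space depending on the history is accommodated by a disjoint union,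
   densities being extended by 0. Measurability of the adversary's choices is
   what gives the view a distribution. *)
Record adversary (E : nat -> mechanism_class) := Adversary {
  out_display : nat -> measure_display ;
  coin_display : nat -> measure_display ;
  out_space : forall i, measurableType (out_display i) ;
  coin_space : forall i, measurableType (coin_display i) ;
  coin0 : probability (coin_space 0) R ;
  coin : forall i, R.-pker (history out_space coin_space i * out_space i)%type
                     ~> coin_space i.+1 ;
  select : forall i, history out_space coin_space i -> selection (E i) (out_space i) ;
  select_measurable : forall i (b : bool),
    measurable_fun [set: history out_space coin_space i]
      (fun h => sel_law (sel_data (select h) b) : pprobability (out_space i) R) }.

Fixpoint view E (A : adversary E) (b : bool) (i : nat) :
    probability (history (out_space A) (coin_space A) i) R :=
  match i return probability (history (out_space A) (coin_space A) i) R with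
  | 0 => coin0 A
  | j.+1 => semidirect
      (semidirect (view A b j) (kprobability (@select_measurable E A j b)))
      (coin A j)
  end.

Lemma bit_neighbor_sym (b b' : bool) : b != b' -> b' != b.
Proof. by rewrite eq_sym. Qed.

Definition bit_universe : universe :=
  @Universe bool (fun b b' => b != b') bit_neighbor_sym.

Definition adacomp E (A : adversary E) (k : nat) : mechanism bit_universe :=
  @Mechanism bit_universe _ (history (out_space A) (coin_space A) k)
    (fun b => view A b k).

Variant adaptive_br (eps : R) (k : nat) : mechanism_class :=
  AdaptiveBR (A : adversary (fun=> bounded_range eps))
  : adaptive_br eps k (adacomp A k).

End mechanisms.

(* Main.v *)
(** A pair of neighbours fed to an eps-BR mechanism has a likelihood ratio in an
    interval [a / E, a] with E = exp eps and 1 <= a <= E. Since hockey-stick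
    divergences are convex in the ratio, the worst mechanism with this interval
    is the biased coin with ratios a and a / E. So both optimal deltas become
    optimal control problems for a martingale s started at 1 with payoff
    (s - G)_+, where G = exp eps_g: the labels a_1, ..., a_k are chosen in
    advance in the nonadaptive case, and along a strategy in the adaptive one.

    If G >= E^(k-1), only the path on which all coins show their high ratio pays
    off; a strategy chooses a fixed list of labels along it.

    For 1 <= G <= E^(k-3), take the best list (by compactness) and suppose that
    no strategy beats it. With one round left at ratio s in ]G/E, G E[ the
    optimal label is exactly sqrt (G E / s). As the reachable s differ by powers
    of E, all labels are equal to some a with a^(k+1) = G E^(n+1) and a^2 >= E,
    and a^2 = E if n > 0. Then some reachable state has a worthless list ahead
    of it though a positive payoff is still possible there: the state after one
    low outcome if n = 0; the state after n + 1 low outcomes with two rounds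
    left if n > 0, which needs n + 1 <= k - 2 and hence k >= 4. *)

Require Import Defs.
From mathcomp Require Import all_boot all_order all_algebra.
From mathcomp Require Import all_classical all_reals all_analysis.
From mathcomp Require Import measurable_realfun.
From mathcomp Require Import ring lra zify.
Import Order.TTheory GRing.Theory Num.Theory.
Import numFieldNormedType.Exports.
Local Open Scope classical_set_scope.
Local Open Scope ring_scope.

Set Implicit Arguments.
Unset Strict Implicit.
Unset Printing Implicit Defensive.

(** * Integration against mixtures, densities and semidirect products *)

Section mixtures.
Context d1 d2 (X : measurableType d1) (Y : measurableType d2) (R : realType).
Local Open Scope classical_set_scope.
Local Open Scope ereal_scope.
Import HBNNSimple.

(** The hypothesis [nuE] is the case of indicators; linearity extends it to simple functions and
    monotone convergence to all nonnegative [f]. *)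
Lemma ge0_integral_mixture (mu : {measure set X -> \bar R})
    (k : X -> {measure set Y -> \bar R})
    (mk : forall U : set Y, measurable U -> measurable_fun [set: X] (k ^~ U))
    (nu : {measure set Y -> \bar R})
    (nuE : forall U, measurable U -> nu U = \int[mu]_x (k x U))
    (f : Y -> \bar R) (f0 : forall y, 0 <= f y) (mf : measurable_fun [set: Y] f) :
  \int[nu]_y f y = \int[mu]_x \int[k x]_y f y.
Proof.
have nnsfun_mixture (h : {nnsfun Y >-> R}) :
    \int[nu]_y (h y)%:E = \int[mu]_x \int[k x]_y (h y)%:E.
  rewrite integral_nnsfun// patch_setT sintegralE.
  under [RHS]eq_integral do rewrite integral_nnsfun// patch_setT sintegralE.
  rewrite ge0_integral_fsum//=; first last.
  - by move=> r x _; exact: nnsfun_mulemu_ge0.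
  - by move=> r; apply/measurable_funeM/mk.
  apply: eq_fsbigr => r /[!inE] -[y _ <-].
  by rewrite nuE// ge0_integralZl_EFin//; exact: mk.
pose h := nnsfun_approx measurableT mf.
have hE y : f y = lim ((h n y)%:E @[n --> \oo]).
  by apply/esym/cvg_lim => //; exact: cvg_nnsfun_approx.
have mh n : measurable_fun [set: Y] (EFin \o h n) by exact/measurable_EFinP.
have h0 n y : 0 <= (h n y)%:E by rewrite lee_fin.
have nh y m n : (m <= n)%N -> (h m y)%:E <= (h n y)%:E.
  by move=> mn; rewrite lee_fin; exact/lefP/nd_nnsfun_approx.
have lim_int (m : {measure set Y -> \bar R}) :
    \int[m]_y f y = lim (\int[m]_y (h n y)%:E @[n --> \oo]).
  under eq_integral do rewrite hE.
  by rewrite monotone_convergence// => y _ m' n'; exact: nh.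
rewrite lim_int; under eq_fun do rewrite nnsfun_mixture.
under [RHS]eq_integral do rewrite lim_int.
rewrite -monotone_convergence//.
- by move=> n; exact: (measurable_fun_integral_kernel mk (h0 n) (mh n)).
- by move=> n x _; exact: integral_ge0.
- move=> x _ m n mn; apply: ge0_le_integral => //.
  + exact: mh.
  + exact: mh.
  + by move=> y _; exact: nh.
Qed.

End mixtures.

(** A measure with density [p] is the mixture of the point masses at y with weights p y. *)
Lemma ge0_integral_density d (T : measurableType d) (R : realType)
    (mu nu : {measure set T -> \bar R}) (p : T -> R)
    (p0 : forall y, 0 <= p y) (mp : measurable_fun [set: T] p)
    (nuE : forall S, measurable S -> nu S = (\int[mu]_(y in S) (p y)%:E)%E)
    (f : T -> \bar R) (f0 : forall y, (0 <= f y)%E)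
    (mf : measurable_fun [set: T] f) :
  (\int[nu]_y f y = \int[mu]_y ((p y)%:E * f y))%E.
Proof.
pose k y : {measure set T -> \bar R} := mscale (NngNum (p0 y)) (dirac y).
rewrite (@ge0_integral_mixture _ _ _ _ _ mu k)//.
- apply: eq_integral => y _.
  by rewrite ge0_integral_mscale//= integral_dirac// diracT mul1e.
- move=> U mU; apply: emeasurable_funM; first exact/measurable_EFinP.
  by apply/measurable_EFinP; exact: measurable_indic.
- move=> U mU; rewrite nuE// integral_mkcond; apply: eq_integral => y _.
  by rewrite patchE /k /= /mscale/= diracE; case: ifP; rewrite ?mule1 ?mule0.
Qed.

Section semidirect_integral.
Context d1 d2 (T1 : measurableType d1) (T2 : measurableType d2)
  (R : realType) (P : probability T1 R) (K : R.-pker T1 ~> T2).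
Local Open Scope ereal_scope.

(** The semidirect product is the mixture over x of the images of [K x] under [pair x]. *)
Lemma ge0_integral_semidirect (f : T1 * T2 -> \bar R) (f0 : forall z, 0 <= f z)
    (mf : measurable_fun [set: T1 * T2] f) :
  \int[semidirect P K]_z f z = \int[P]_x \int[K x]_y f (x, y).
Proof.
have mpair x : measurable_fun [set: T2] (pair x : T2 -> T1 * T2).
  exact: measurable_pair1.
pose k x : {measure set (T1 * T2)%type -> \bar R} := pushforward (K x) (pair x).
rewrite (@ge0_integral_mixture _ _ _ _ _ P (k mpair))//.
- by apply: eq_integral => x _; rewrite ge0_integral_pushforward.
- move=> U mU; rewrite (_ : (k mpair)^~ U = fun x => K x (xsection U x)).
    by apply: (measurable_fun_xsection_finite_kernel K); rewrite inE.
  by apply/funext => x; rewrite /k /= /pushforward xsectionE.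
- move=> U mU; apply: eq_integral => x _.
  by rewrite /k /= /pushforward xsectionE.
Qed.

End semidirect_integral.

(** * Two-point rounds and convexity *)

Section rounds.
Context (R : realType).
Implicit Types (E G a s : R) (g : R -> R).

(* A round whose likelihood ratio is a with probability hi_prob E a under the
   denominator law, and a / E otherwise; the mean ratio is 1. *)
Definition hi_prob E a : R := (E - a) / (a * (E - 1)).

Definition round E a g (s : R) : R :=
  hi_prob E a * g (s * a) + (1 - hi_prob E a) * g (s * a / E).

(** Convexity on the nonnegative half-line, with denominators cleared. *)
Definition below_chords g := forall x y z : R, 0 <= x -> x <= y -> y <= z ->
  (z - x) * g y <= (z - y) * g x + (y - x) * g z.

Lemma hi_prob_ge0 E a : 1 < E -> 1 <= a <= E -> 0 <= hi_prob E a.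
Proof. by move=> E1 /andP[a1 aE]; rewrite divr_ge0 ?mulr_ge0//; lra. Qed.

Lemma hi_probC E a : 1 < E -> 1 <= a ->
  1 - hi_prob E a = E * (a - 1) / (a * (E - 1)).
Proof. by move=> E1 a1; rewrite /hi_prob; field; lra. Qed.

Lemma hi_prob_le1 E a : 1 < E -> 1 <= a -> hi_prob E a <= 1.
Proof.
move=> E1 a1; rewrite -subr_ge0 hi_probC// divr_ge0// mulr_ge0//; lra.
Qed.

Lemma hi_prob01 E a : 1 < E -> 1 <= a <= E -> 0 <= hi_prob E a <= 1.
Proof.
by move=> E1 aE; rewrite hi_prob_ge0// hi_prob_le1//; case/andP: aE.
Qed.

End rounds.

(** * Domination of a bounded-range mechanism by a two-point round *)

Section bounded_range_step.
Context (R : realType) (U : universe) (M : mechanism R U) (eps : R).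
Local Notation E := (expR eps).

(** [a] is the supremum of p / p' where p' is positive. Where p' vanishes, comparison with a point
    where it does not shows that p vanishes too. *)
Lemma ratio_range (T : Type) (p p' : T -> R) (e : R) :
  0 <= e -> (forall y, 0 <= p y) -> (forall y, 0 <= p' y) ->
  (exists y, 0 < p' y) ->
  (forall y1 y2, p y1 * p' y2 <= e * (p y2 * p' y1)) ->
  exists2 a : R, 0 <= a &
    forall y, p y <= a * p' y /\ a * p' y <= e * p y.
Proof.
move=> e0 p0 p'0 [y0 p'y0] br.
pose A := [set p y / p' y | y in [set y | 0 < p' y]].
have ub y : 0 < p' y -> ubound A (e * (p y / p' y)).
  move=> p'y _ [z p'z <-]; rewrite ler_pdivrMr// -(ler_pM2r p'y).
  have -> : e * (p y / p' y) * p' z * p' y = e * (p y * p' z).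
    by field; rewrite gt_eqF.
  exact: br.
have supA : has_sup A.
  split; first by exists (p y0 / p' y0), y0.
  by exists (e * (p y0 / p' y0)); exact: ub.
have geA y : 0 < p' y -> p y / p' y <= sup A.
  by move=> p'y; apply: sup_upper_bound => //; exists y.
exists (sup A); first by rewrite (le_trans _ (geA _ p'y0))// divr_ge0.
move=> y; have [p'y|] := ltP 0 (p' y).
  split; first by rewrite -ler_pdivrMr// geA.
  rewrite -ler_pdivlMr// -mulrA; apply: sup_le_ub; [|exact: ub].
  by case: supA.
move=> p'y; have {}p'y : p' y = 0 by apply/le_anti; rewrite p'y p'0.
have -> : p y = 0.
  apply/le_anti; rewrite p0 andbT -(pmulr_lle0 _ p'y0).
  by rewrite (le_trans (br y y0))// p'y !mulr0.
by rewrite p'y !mulr0.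
Qed.

(** The outcome y multiplies the ratio s by L = p x y / p x' y, which lies in [a / E, a]. Convexity
    puts g (s * L) below the chord of g over [s * a / E, s * a]; this chord is affine in L, and L
    has mean 1 under the law of x', so its mean is the value of the round. The label depends only on
    the mechanism and the pair, and serves all [G], [s], [g], [f] and [f']. *)
Lemma bounded_range_step (eps_gt0 : 0 < eps) (brM : bounded_range eps M)
    (x x' : dataset U) (xx' : neighbor x x') :
  exists2 a : R, 1 <= a <= E &
  forall (G s : R) (g : R -> R) (f f' : outcome M -> \bar R),
    0 <= G -> 0 <= s -> (forall u, 0 <= u -> 0 <= g u) -> below_chords g ->
    (forall y, (0 <= f y)%E) -> (forall y, (0 <= f' y)%E) ->
    measurable_fun [set: outcome M] f -> measurable_fun [set: outcome M] f' ->
    (forall y (u : R), 0 <= u <= s * E ->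
      (u%:E * f y <= G%:E * f' y + (g u)%:E)%E) ->
    (s%:E * \int[law M x]_y f y
      <= G%:E * \int[law M x']_y f' y + (round E a g s)%:E)%E.
Proof.
case: brM => mu [p [mp p0 lawE br]].
have E1 : 1 < E by rewrite expR_gt1.
have E0 : 0 < E by lra.
have int1 z : (\int[mu]_y (p z y)%:E = 1)%E by rewrite -lawE// probability_setT.
have ex_p' : exists y, 0 < p x' y.
  apply: contrapT => /forallNP p'0; have := int1 x'.
  rewrite integral0_eq; first by move/eqP; rewrite eq_sym onee_eq0.
  move=> y _; congr EFin; apply/le_anti; rewrite p0 andbT leNgt.
  exact/negP/p'0.
have [a a0 aP] := ratio_range (ltW E0) (p0 x) (p0 x') ex_p' (br _ _ xx').
have mpE z : measurable_fun [set: outcome M] (EFin \o p z) by exact/measurable_EFinP.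
have pE0 z y : (0 <= (p z y)%:E)%E by rewrite lee_fin.
have a1 : 1 <= a.
  have : (\int[mu]_y (p x y)%:E <= \int[mu]_y (a%:E * (p x' y)%:E))%E.
    apply: ge0_le_integral => //; [exact: mpE|exact/measurable_funeM/mpE|].
    by move=> y _; rewrite -EFinM lee_fin; case: (aP y).
  by rewrite ge0_integralZl//; [rewrite !int1 mule1 lee_fin|exact: mpE].
have aE : a <= E.
  have : (\int[mu]_y (a%:E * (p x' y)%:E) <= \int[mu]_y (E%:E * (p x y)%:E))%E.
    apply: ge0_le_integral => //; [|exact/measurable_funeM/mpE|
      exact/measurable_funeM/mpE|].
      by move=> y _; rewrite -EFinM lee_fin mulr_ge0.
    by move=> y _; rewrite -!EFinM lee_fin; case: (aP y).
  rewrite ge0_integralZl//; last exact: mpE.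
  rewrite ge0_integralZl//; last exact: mpE.
  by rewrite !int1 !mule1 lee_fin.
exists a; first by rewrite a1.
move=> G s g f f' G0 s0 g0 cg f0 f'0 mf mf' dom.
pose b := a / E.
have bE : b * E = a by rewrite /b divfK//; lra.
have b0 : 0 < b by rewrite divr_gt0//; lra.
have ab : b < a by rewrite ltr_pdivrMr// ltr_pMr//; lra.
(* Multiplied by p x' y, the distances L - b and a - L become [lo] and [up], which make sense even
   where p x' y = 0. The chord bound becomes c1 * lo + c2 * up, a sum of nonnegative terms. *)
pose lo y := p x y - b * p x' y.
pose up y := a * p x' y - p x y.
have lo0 y : 0 <= lo y.
  have [_ /=] := aP y; rewrite /lo subr_ge0 -(ler_pM2r E0) mulrAC bE => H.
  by rewrite (mulrC (p x y)).
have up0 y : 0 <= up y by rewrite subr_ge0; case: (aP y).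
have mlo : measurable_fun [set: outcome M] (EFin \o lo).
  by apply/measurable_EFinP; apply: measurable_funB => //; exact: measurable_funM.
have mup : measurable_fun [set: outcome M] (EFin \o up).
  by apply/measurable_EFinP; apply: measurable_funB => //; exact: measurable_funM.
have int_lo : (\int[mu]_y (lo y)%:E = (1 - b)%:E)%E.
  have : (\int[mu]_y ((lo y)%:E + b%:E * (p x' y)%:E) = 1)%E.
    by rewrite -(int1 x); apply: eq_integral => y _; rewrite -EFinM -EFinD subrK.
  rewrite ge0_integralD//; first last.
  - exact/measurable_funeM/mpE.
  - by move=> y _; rewrite -EFinM lee_fin mulr_ge0// ltW.
  - by move=> y _; rewrite lee_fin.
  rewrite ge0_integralZl//; [|exact: mpE|by rewrite lee_fin ltW].
  rewrite int1 mule1 => H; rewrite EFinB -H addeK//.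
have int_up : (\int[mu]_y (up y)%:E = (a - 1)%:E)%E.
  have : (\int[mu]_y ((up y)%:E + (p x y)%:E) = a%:E)%E.
    rewrite -[RHS]mule1 -(int1 x') -ge0_integralZl//; last exact: mpE.
    by apply: eq_integral => y _; rewrite -EFinM -EFinD subrK.
  rewrite ge0_integralD//; first last.
  - exact: mpE.
  - by move=> y _; rewrite lee_fin.
  by rewrite int1 => H; rewrite EFinB -H addeK.
pose c1 := g (s * a) / (a - b).
pose c2 := g (s * a / E) / (a - b).
have ab0 : 0 < a - b by rewrite subr_gt0.
have c10 : 0 <= c1 by rewrite divr_ge0 ?(ltW ab0)// g0 ?mulr_ge0.
have c20 : 0 <= c2 by rewrite divr_ge0 ?(ltW ab0)// g0 ?divr_ge0 ?mulr_ge0 ?(ltW E0).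
have roundE : round E a g s = c1 * (1 - b) + c2 * (a - 1).
  have -> : a - 1 = (a - b) - (1 - b) by ring.
  have abE : a - b = a * (E - 1) / E by rewrite /b; field; rewrite gt_eqF.
  rewrite /round /c1 /c2 abE /hi_prob /b; field.
  by rewrite ?gt_eqF//=; lra.
have ptw y : (s%:E * ((p x y)%:E * f y) <= G%:E * ((p x' y)%:E * f' y) +
    (c1%:E * (lo y)%:E + c2%:E * (up y)%:E))%E.
  have [p'y|] := ltP 0 (p x' y); last first.
    move=> p'y; have {}p'y : p x' y = 0 by apply/le_anti; rewrite p'y p0.
    have -> : p x y = 0.
      by have [+ _] := aP y; rewrite p'y mulr0 => H; apply/le_anti; rewrite H p0.
    rewrite mul0e mule0 adde_ge0// ?mule_ge0// ?adde_ge0// ?mule_ge0//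
      ?lee_fin//.
  pose L := p x y / p x' y.
  have pL : p x y = L * p x' y by rewrite /L divfK// gt_eqF.
  have La : L <= a by rewrite ler_pdivrMr//; case: (aP y).
  have bL : b <= L by rewrite ler_pdivlMr// -subr_ge0; exact: lo0.
  have L0 : 0 <= L by rewrite (le_trans (ltW b0)).
  have gL0 := g0 _ (mulr_ge0 s0 L0).
  have chord : g (s * L) <= c1 * (L - b) + c2 * (a - L).
    (* At s = 0 the three points of the chord coincide and convexity says nothing, but both sides
       are equal to g 0. *)
    have [s_gt0|s_le0] := ltP 0 s; last first.
      rewrite /c1 /c2; have -> : s = 0 by apply/le_anti; rewrite s0 s_le0.
      rewrite !mul0r le_eqVlt; apply/orP; left; apply/eqP.
      by field; rewrite gt_eqF.
    have sb : s * b = s * a / E by rewrite /b mulrA.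
    have := cg (s * b) (s * L) (s * a) (mulr_ge0 s0 (ltW b0)).
    rewrite !ler_pM2l// => /(_ bL La).
    move=> cgs; have {cgs} H : s * ((a - b) * g (s * L)) <=
        s * ((a - L) * g (s * b) + (L - b) * g (s * a)) by lra.
    rewrite ler_pM2l// in H.
    have -> : c1 * (L - b) + c2 * (a - L) =
        ((a - L) * g (s * b) + (L - b) * g (s * a)) / (a - b).
      by rewrite /c1 /c2 -sb; field; rewrite gt_eqF.
    by rewrite ler_pdivlMr// mulrC.
  have := dom y (s * L); rewrite mulr_ge0// ler_wpM2l// ?(le_trans La)// => /(_ isT).
  move/(lee_wpmul2l (pE0 x' y)) => H.
  rewrite muleA -EFinM pL mulrA mulrC EFinM -muleA; apply: (le_trans H).
  rewrite ge0_muleDr ?mule_ge0// ?lee_fin// muleCA leeD2l//.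
  rewrite -!EFinM -EFinD lee_fin.
  have -> : c1 * lo y + c2 * up y = p x' y * (c1 * (L - b) + c2 * (a - L)).
    by rewrite /lo /up pL; ring.
  by rewrite ler_wpM2l// ltW.
have mpf z (h : outcome M -> \bar R) : measurable_fun [set: outcome M] h ->
    measurable_fun [set: outcome M] (fun y => (p z y)%:E * h y)%E.
  by move=> mh; apply: emeasurable_funM => //; exact: mpE.
have densE z (h : outcome M -> \bar R) : (forall y, 0 <= h y)%E ->
    measurable_fun [set: outcome M] h ->
    (\int[law M z]_y h y = \int[mu]_y ((p z y)%:E * h y))%E.
  by move=> h0 mh; apply: ge0_integral_density => //; exact: lawE.
rewrite densE// densE//.
rewrite -ge0_integralZl//; [|exact: mpf|by move=> y _; rewrite mule_ge0].
rewrite -ge0_integralZl//; [|exact: mpf|by move=> y _; rewrite mule_ge0].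
have -> : (round E a g s)%:E =
    (\int[mu]_y (c1%:E * (lo y)%:E + c2%:E * (up y)%:E))%E.
  rewrite ge0_integralD//; first last.
  - exact: measurable_funeM.
  - by move=> y _; rewrite mule_ge0// lee_fin.
  - exact: measurable_funeM.
  - by move=> y _; rewrite mule_ge0// lee_fin.
  rewrite !ge0_integralZl ?lee_fin//; first last.
  - by move=> y _; rewrite lee_fin.
  - by move=> y _; rewrite lee_fin.
  by rewrite int_lo int_up -!EFinM -EFinD roundE.
rewrite -ge0_integralD//; first last.
- by apply: emeasurable_funD; exact: measurable_funeM.
- by move=> y _; rewrite adde_ge0// mule_ge0// lee_fin.
- exact/measurable_funeM/mpf.
- by move=> y _; rewrite !mule_ge0// lee_fin.
apply: ge0_le_integral => //.
- by move=> y _; rewrite !mule_ge0// lee_fin.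
- exact/measurable_funeM/mpf.
- apply: emeasurable_funD; first exact/measurable_funeM/mpf.
  by apply: emeasurable_funD; exact: measurable_funeM.
Qed.

End bounded_range_step.

(** * Values of label lists and of adaptive strategies *)

Section values.
Context (R : realType).
Implicit Types (E G a s : R) (g : R -> R) (l : seq R).

Definition payoff G s : R := Num.max (s - G) 0.

Definition run E l g : R -> R := foldr (round E) g l.

Definition fixed_value E G l : R -> R := run E l (payoff G).

Definition in_range E a := 1 <= a <= E.

(* The label chosen after the outcomes h, oldest first; true is the likely
   outcome of the numerator. *)
Definition strategy := seq bool -> R.

Fixpoint value E G (n : nat) (sigma : strategy) s : R :=
  if n is m.+1 then
    hi_prob E (sigma [::]) *
      value E G m (fun h => sigma (true :: h)) (s * sigma [::]) +
    (1 - hi_prob E (sigma [::])) *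
      value E G m (fun h => sigma (false :: h)) (s * sigma [::] / E)
  else payoff G s.

(** The default 1 keeps the strategy in range on histories longer than the list. *)
Definition fixed l : strategy := fun h => nth 1 l (size h).

(** The continuation is indexed by the ratio reached rather than by the outcomes, since the payoff
    ahead depends on them only through this ratio. *)
Fixpoint follow E l (C : R -> strategy) s : strategy := fun h =>
  match l, h with
  | [::], _ => C s h
  | a :: _, [::] => a
  | a :: l', b :: h' => follow E l' C (if b then s * a else s * a / E) h'
  end.

Lemma payoff_ge0 G s : 0 <= payoff G s.
Proof. by rewrite le_max lexx orbT. Qed.

Lemma payoff_eq0 G s : s <= G -> payoff G s = 0.
Proof. by move=> sG; apply/max_idPr; rewrite subr_le0. Qed.

Lemma payoffE G s : G <= s -> payoff G s = s - G.
Proof. by move=> sG; apply/max_idPl; rewrite subr_ge0. Qed.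

Lemma below_chords_payoff G : below_chords (payoff G).
Proof.
move=> x y z x0 xy yz; have [yG|/ltW Gy] := leP y G.
  rewrite payoff_eq0// mulr0 addr_ge0// mulr_ge0 ?payoff_ge0// subr_ge0//.
rewrite (payoffE Gy) (payoffE (le_trans Gy yz)).
have : x - G <= payoff G x by rewrite le_max lexx.
rewrite -subr_ge0 => H; rewrite -subr_ge0.
have -> : (z - y) * payoff G x + (y - x) * (z - G) - (z - x) * (y - G) =
  (z - y) * (payoff G x - (x - G)) by ring.
by rewrite mulr_ge0// subr_ge0.
Qed.

Section range.
Context (E G : R) (E1 : 1 < E).

Let E0 : 0 < E. Proof. by rewrite (lt_trans ltr01). Qed.

Lemma round_ge0 a g s : in_range E a -> (forall u, 0 <= g u) ->
  0 <= round E a g s.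
Proof.
move=> ar g0; have /andP[q0 q1] := hi_prob01 E1 ar.
by rewrite addr_ge0// mulr_ge0// subr_ge0.
Qed.

(** The martingale property of the likelihood ratio. *)
Lemma round_mean a s : 1 <= a -> round E a id s = s.
Proof.
by move=> a1; rewrite /round hi_probC// /hi_prob; field; move: E1; lra.
Qed.

Lemma round_le a g g' s : in_range E a -> g (s * a) <= g' (s * a) ->
  g (s * a / E) <= g' (s * a / E) -> round E a g s <= round E a g' s.
Proof.
move=> ar gg' gg'E; have /andP[q0 q1] := hi_prob01 E1 ar.
by rewrite lerD// ler_wpM2l// subr_ge0.
Qed.

Lemma below_chords_round a g : in_range E a -> below_chords g ->
  below_chords (round E a g).
Proof.
move=> ar cg x y z x0 xy yz.
have /andP[q0] := hi_prob01 E1 ar; rewrite -subr_ge0 => q1.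
have a0 : 0 < a by case/andP: ar; lra.
have scaled c : 0 < c -> (z - x) * g (y * c) <=
    (z - y) * g (x * c) + (y - x) * g (z * c).
  move=> c0; have := cg (x * c) (y * c) (z * c).
  rewrite !ler_pM2r// mulr_ge0 ?(ltW c0)//.
  by move=> /(_ isT xy yz) H; rewrite -(ler_pM2r c0); lra.
have H1 := scaled _ a0; have H2 := scaled _ (divr_gt0 a0 E0).
have := lerD (ler_wpM2l q0 H1) (ler_wpM2l q1 H2); rewrite !(mulrA _ a).
rewrite /round; move: (hi_prob E a) (g _) (g _) (g _) (g _) (g _) (g _).
move=> *; lra.
Qed.

Lemma run_ge0 l g s : all (in_range E) l -> (forall u, 0 <= g u) ->
  0 <= run E l g s.
Proof.
move=> + g0; elim: l s => //= a l IH s /andP[ar lr].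
by apply: round_ge0 => // u; exact: IH.
Qed.

Lemma fixed_value_ge0 l s : all (in_range E) l -> 0 <= fixed_value E G l s.
Proof. by move=> lr; apply: run_ge0 => // u; exact: payoff_ge0. Qed.

Lemma below_chords_fixed_value l : all (in_range E) l ->
  below_chords (fixed_value E G l).
Proof.
elim: l => [_|a l IH /andP[ar /IH]]; first exact: below_chords_payoff.
exact: below_chords_round.
Qed.

Lemma fixed_value_le_id l s : 0 <= G -> all (in_range E) l -> 0 <= s ->
  fixed_value E G l s <= s.
Proof.
move=> G0; elim: l s => [s _ s0|a l IH s /andP[ar lr] s0].
  by rewrite ge_max s0 andbT gerBl.
have a1 : 1 <= a by case/andP: ar.
rewrite -[leRHS](round_mean s a1); apply: round_le => //; apply: IH => //.
  by rewrite mulr_ge0//; lra.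
by rewrite divr_ge0 ?(ltW E0) ?mulr_ge0 ?(le_trans ler01 a1).
Qed.

Lemma prod_range_ge0 l : all (in_range E) l -> 0 <= \prod_(a <- l) a.
Proof.
move=> lr; rewrite big_seq; apply: prodr_ge0 => a al.
by case/andP: (allP lr _ al) => a1 _; rewrite (le_trans ler01).
Qed.

Lemma prod_range_le l : all (in_range E) l -> \prod_(a <- l) a <= E ^+ size l.
Proof.
elim: l => [_|a l IH /= /andP[/andP[a1 aE] lr]]; first by rewrite big_nil.
rewrite big_cons exprS ler_pM ?IH ?prod_range_ge0//; lra.
Qed.

(** The path of high outcomes reaches the largest final ratio, s times the product of the labels; if
    this is at most G, no path pays. *)
Lemma fixed_value_eq0 l s : all (in_range E) l -> 0 <= s ->
  s * \prod_(a <- l) a <= G -> fixed_value E G l s = 0.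
Proof.
elim: l s => [s _ _|a l IH s /= /andP[ar lr] s0].
  by rewrite big_nil mulr1 => /payoff_eq0.
have a1 : 1 <= a by case/andP: ar.
rewrite big_cons mulrA /fixed_value/= /round => sG.
rewrite ![run _ _ _ _]IH ?mulr0 ?addr0//.
- by rewrite divr_ge0 ?(ltW E0) ?mulr_ge0 ?(le_trans ler01 a1).
- apply: le_trans sG; rewrite ler_wpM2r ?prod_range_ge0//.
  by rewrite ler_pdivrMr// ler_peMr ?(ltW E1)// mulr_ge0// (le_trans ler01).
- by rewrite mulr_ge0// (le_trans ler01).
Qed.

Lemma value_fixed l s : value E G (size l) (fixed l) s = fixed_value E G l s.
Proof.
elim: l s => //= a l IH s.
by rewrite -[RHS]/(round E a (fixed_value E G l) s) /round -!IH.
Qed.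

Lemma value_follow l C n s : value E G (size l + n) (follow E l C s) s =
  run E l (fun u => value E G n (C u) u) s.
Proof. by elim: l s => //= a l IH s; rewrite /round -!IH. Qed.

Lemma fixed_range l : all (in_range E) l -> forall h, in_range E (fixed l h).
Proof.
move=> lr h; rewrite /fixed; have [hl|lh] := ltnP (size h) (size l).
  exact: all_nthP hl.
by rewrite nth_default// /in_range lexx ltW.
Qed.

Lemma follow_range l C s : all (in_range E) l ->
  (forall u h, in_range E (C u h)) -> forall h, in_range E (follow E l C s h).
Proof.
move=> + Cr; elim: l s => [|a l IH] s /=; first by move=> _; exact: Cr.
by move=> /andP[ar lr] [|b h] //; exact: IH.
Qed.

End range.
End values.

(** * Reordering of rounds and strict improvements *)

Section improvement.
Context (R : realType) (E G : R) (E1 : 1 < E) (G0 : 0 < G).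
Implicit Types (a s u : R) (g : R -> R) (l r : seq R).

Let E0 : 0 < E. Proof. by rewrite (lt_trans ltr01). Qed.

Local Notation interior := (fun a : R => 1 < a < E).

Lemma interior_in_range a : 1 < a < E -> in_range E a.
Proof. by move=> /andP[/ltW a1 /ltW aE]; rewrite /in_range a1. Qed.

Lemma all_interior_in_range l : all interior l -> all (in_range E) l.
Proof. by apply: sub_all => a; exact: interior_in_range. Qed.

Lemma hi_prob_interior a : 1 < a < E -> 0 < hi_prob E a < 1.
Proof.
move=> /andP[a1 aE]; rewrite divr_gt0 ?mulr_gt0//=; [|move: E1; lra..].
by rewrite -subr_gt0 hi_probC ?(ltW a1)// divr_gt0 ?mulr_gt0//; move: E1; lra.
Qed.

(** With label 1 the high ratio 1 is certain; with label E the low ratio E / E is. *)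
Lemma round_noop a g s : (a == 1) || (a == E) -> round E a g s = g s.
Proof.
have E1' : E - 1 != 0 by rewrite subr_eq0 gt_eqF.
have E0' : E != 0 by rewrite gt_eqF.
case/orP=> /eqP->; rewrite /round /hi_prob.
  by rewrite !mul1r divff// mul1r mulr1 subrr mul0r addr0.
by rewrite subrr !mul0r add0r subr0 mul1r mulfK.
Qed.

(** The two orders give the same four ratios with the same weights. This allows any label of a list
    to be played last. *)
Lemma roundC a b g : round E a (round E b g) = round E b (round E a g).
Proof.
apply/funext => s; rewrite /round.
have -> : s * b * a = s * a * b by rewrite mulrAC.
have -> : s * a / E * b = s * a * b / E by rewrite mulrAC.
have -> : s * b / E * a = s * a * b / E by rewrite mulrAC (mulrAC s b).
by ring.
Qed.

Lemma run_round a l g : run E l (round E a g) = round E a (run E l g).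
Proof. by elim: l => //= b l ->; rewrite roundC. Qed.

Lemma run_cat l1 l2 g : run E (l1 ++ l2) g = run E l1 (run E l2 g).
Proof. exact: foldr_cat. Qed.

Lemma run_partition (p : pred R) l g :
  run E l g = run E [seq a <- l | p a] (run E [seq a <- l | ~~ p a] g).
Proof.
elim: l => //= a l IH; case: (p a) => /=; first by rewrite -IH.
by rewrite run_round -IH.
Qed.

Lemma run_noop l g : all (fun a => (a == 1) || (a == E)) l -> run E l g = g.
Proof.
elim: l => //= a l IH /andP[al /IH ->].
by apply/funext => s; rewrite round_noop.
Qed.

Lemma run_le l g g' s : all (in_range E) l -> (forall u, g u <= g' u) ->
  run E l g s <= run E l g' s.
Proof.
move=> + gg'; elim: l s => //= a l IH s /andP[ar lr].
by apply: round_le => //; exact: IH.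
Qed.

(** Interior labels give both outcomes positive probability, so the ratio reached after m low
    outcomes has positive weight, and a strict gain there survives the averaging. *)
Lemma run_lt l g g' s m : all interior l -> (forall u, g u <= g' u) ->
    (m <= size l)%N ->
    let t := s * \prod_(a <- l) a / E ^+ m in g t < g' t ->
  run E l g s < run E l g' s.
Proof.
move=> + gg' + t; rewrite {}/t.
elim: l s m => [s m _|a l IH s m /= /andP[ai li] ml].
  by rewrite leqn0 big_nil => /eqP ->; rewrite mulr1 divr1.
have [q0 q1] := andP (hi_prob_interior ai); rewrite -subr_gt0 in q1.
have lr := all_interior_in_range li.
(* The low outcomes are put last: the head label shows its high ratio unless all labels have to show
   the low one. *)
rewrite big_cons mulrA; have [ml' gt|lm] := leqP m (size l).
  apply: ltr_leD; first by rewrite ltr_pM2l//; exact: IH gt.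
  by rewrite ler_pM2l//; exact: run_le.
have -> : m = (size l).+1 by apply/eqP; rewrite eqn_leq ml.
rewrite exprS invfM mulrA (mulrAC (s * a)) => gt; apply: ler_ltD.
  by rewrite ler_pM2l//; exact: run_le.
by rewrite ltr_pM2l//; exact: IH gt.
Qed.

(** Labels close enough to E keep the path of high outcomes above G, and labels below E give this
    path positive probability. *)
Lemma fixed_value_gt0 n s : 0 < s -> G < s * E ^+ n ->
  exists l, [/\ size l = n, all (in_range E) l & 0 < fixed_value E G l s].
Proof.
elim: n s => [s _|n IH s s0 sE].
  rewrite expr0 mulr1 => sG; exists [::]; split => //.
  by rewrite /fixed_value /= lt_max subr_gt0 sG.
have En0 : 0 < s * E ^+ n by rewrite mulr_gt0 ?exprn_gt0.
(* Any label strictly between [b] and E preserves the hypothesis for the n remaining rounds; the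
   midpoint is taken. *)
pose b := Num.max 1 (G / (s * E ^+ n)).
have bE : b < E.
  by rewrite gt_max E1 ltr_pdivrMr//= mulrCA -exprS.
have b1 : 1 <= b by rewrite le_max lexx.
have bG : G / (s * E ^+ n) <= b by rewrite le_max lexx orbT.
pose a := (b + E) / 2.
have ba : b < a by rewrite /a; lra.
have ai : 1 < a < E by rewrite (le_lt_trans b1 ba) /a; lra.
have a0 : 0 < a by rewrite (lt_trans ltr01)//; case/andP: ai.
have [||l [ln lr l0]] := IH (s * a); first exact: mulr_gt0.
  by rewrite mulrAC mulrC -ltr_pdivrMr// (le_lt_trans bG ba).
exists (a :: l); split => /=; first by rewrite ln.
  by rewrite interior_in_range.
have [q0 q1] := andP (hi_prob_interior ai); rewrite -subr_gt0 in q1.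
rewrite -[ltRHS]/(round E a (fixed_value E G l) s).
apply: ltr_pwDl; first exact: mulr_gt0.
by rewrite mulr_ge0 ?(ltW q1)// fixed_value_ge0.
Qed.

(** Put t = s * b, so that t^2 = G * s * E. The label [b] earns (s * E + G - 2 * t) / (E - 1). A
    label [a] for which only the high outcome pays falls short of this by (s * a - t)^2 / (s * a),
    up to the factor E - 1. The labels for which no outcome or both outcomes pay earn 0 and s -
    G. *)
Lemma round_payoff_lt a b s : G / E < s -> s < G * E -> in_range E a ->
  0 < b -> b ^+ 2 * s = G * E -> a != b ->
  round E a (payoff G) s < round E b (payoff G) s.
Proof.
move=> GEs sGE /andP[a1 aE] b0 bs ab.
have s0 : 0 < s by rewrite (lt_trans _ GEs)// divr_gt0.
have {}GEs : G < s * E by rewrite -ltr_pdivrMr.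
have a0 : 0 < a by rewrite (lt_le_trans ltr01).
have sb0 : 0 < s * b by rewrite mulr_gt0.
have sb2 : (s * b) ^+ 2 = G * (s * E).
  have -> : G * (s * E) = s * (G * E) by ring.
  by rewrite -bs; ring.
have sbG : G < s * b.
  by rewrite -(ltr_pXn2r (ltn0Sn 1)) ?nnegrE ?(ltW G0) ?(ltW sb0)// sb2 ltr_pM2l.
have sbE : s * b / E < G.
  rewrite ltr_pdivrMr// -(ltr_pXn2r (ltn0Sn 1)) ?nnegrE ?(ltW sb0) ?mulr_ge0 ?ltW//.
  have -> : (G * E) ^+ 2 = G * (G * E * E) by ring.
  by rewrite sb2 ltr_pM2l// ltr_pM2r.
have E10 : 0 < E - 1 by rewrite subr_gt0.
pose t := s * b.
have opt : round E b (payoff G) s = (s * E + G - 2 * t) / (E - 1).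
  rewrite /round (payoffE (ltW sbG)) (payoff_eq0 (ltW sbE)) mulr0 addr0.
  rewrite /hi_prob; apply: (mulIf (lt0r_neq0 b0)); apply: (mulIf (lt0r_neq0 E10)).
  have -> : (s * E + G - 2 * t) / (E - 1) * b * (E - 1) =
            (s * E + G - 2 * t) * b by field; rewrite lt0r_neq0.
  have -> : (E - b) / (b * (E - 1)) * (s * b - G) * b * (E - 1) =
            (E - b) * (s * b - G).
    by field; rewrite !lt0r_neq0.
  by rewrite /t; have : b ^+ 2 * s = G * E by []; rewrite expr2; lra.
rewrite opt ltr_pdivlMr//.
have [saG|Gsa] := leP (s * a) G.
  have saE : s * a / E <= G.
    by rewrite (le_trans _ saG)// ler_pdivrMr// ler_peMr ?(ltW E1)// mulr_ge0 ?ltW.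
  rewrite /round !payoff_eq0// !mulr0 addr0 mul0r.
  (* Strict AM-GM for s * E and G, whose geometric mean is t. *)
  have : 0 < (s * E - G) ^+ 2 by rewrite exprn_gt0// subr_gt0.
  rewrite -/t in sb2 sb0; move: sb2 sb0 G0 GEs; rewrite !expr2.
  by move=> *; nra.
have a10 : hi_prob E a * (s * a - G) * (E - 1) = s * E + G - s * a - G * E / a.
  by rewrite /hi_prob; field; rewrite !lt0r_neq0.
have [saE|GsaE] := leP (s * a / E) G.
  rewrite /round (payoffE (ltW Gsa)) (payoff_eq0 saE) mulr0 addr0 a10.
  have sat : s * a != t by rewrite /t (inj_eq (mulfI (lt0r_neq0 s0))).
  have -> : G * E / a = t ^+ 2 / (s * a).
    by rewrite sb2; field; rewrite !lt0r_neq0.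
  have sa0 : 0 < s * a by rewrite mulr_gt0.
  rewrite -subr_gt0.
  have -> : s * E + G - 2 * t - (s * E + G - s * a - t ^+ 2 / (s * a)) =
      (s * a - t) ^+ 2 / (s * a) by field; rewrite !lt0r_neq0.
  by rewrite divr_gt0// exprn_even_gt0//= subr_eq0.
rewrite /round (payoffE (ltW Gsa)) (payoffE (ltW GsaE)).
have -> : hi_prob E a * (s * a - G) + (1 - hi_prob E a) * (s * a / E - G) =
    round E a id s - G by rewrite /round; ring.
rewrite round_mean//.
(* Strict AM-GM for s and G * E, whose geometric mean is again t. *)
have : 0 < (G * E - s) ^+ 2 by rewrite exprn_gt0// subr_gt0.
rewrite -/t in sb2 sb0; move: sb2 sb0 sGE; rewrite !expr2.
by move=> *; nra.
Qed.

End improvement.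

(** * Existence of a best list and first consequences of unimprovability *)

Section optimum.
Context (R : realType) (E G : R) (E1 : 1 < E) (G0 : 0 < G).
Implicit Types (a s u : R) (g : R -> R) (l r d : seq R).

Let E0 : 0 < E. Proof. by rewrite (lt_trans ltr01). Qed.

Local Notation interior := (fun a : R => 1 < a < E).

(** The starting ratio varies with the labels because, in the induction, it contains the labels
    already played. *)
Lemma continuous_run_payoff n (js : seq 'I_n) (s : 'rV[R]_n -> R) (v : 'rV[R]_n) :
  (forall i, v ord0 i != 0) -> s w @[w --> v] --> s v ->
  (fun w : 'rV[R]_n => run E [seq w ord0 i | i <- js] (payoff G) (s w)) @ v -->
  run E [seq v ord0 i | i <- js] (payoff G) (s v).
Proof.
move=> v0; elim: js s => [s cs|i js IH s cs] /=.
  apply: (@continuous_max R _ (fun w => s w - G) (fun=> 0) v).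
    exact: (cvgB cs (cvg_cst _)).

  exact: cst_continuous.
have ci : (fun w : 'rV[R]_n => w ord0 i) @ v --> v ord0 i by exact: coord_continuous.
have E10 : E - 1 != 0 by rewrite subr_eq0 gt_eqF.
have cq : (fun w : 'rV[R]_n => hi_prob E (w ord0 i)) @ v --> hi_prob E (v ord0 i).
  have q0 : v ord0 i * (E - 1) != 0 by rewrite mulf_neq0.
  exact: (cvgM (cvgB (cvg_cst _) ci) (cvgV q0 (cvgM ci (cvg_cst _)))).
have csi : (fun w : 'rV[R]_n => s w * w ord0 i) @ v --> s v * v ord0 i.
  exact: (cvgM cs ci).
have hi := IH (fun w => s w * w ord0 i) csi.
have lo := IH (fun w => s w * w ord0 i / E) (cvgM csi (cvg_cst _)).
rewrite /round; apply: (cvgD (F := nbhs v)); first exact: (cvgM cq hi).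
apply: (cvgM (F := nbhs v)); last exact: lo.
exact: (cvgB (cvg_cst _) cq).
Qed.

(** Extreme value theorem on the cube [1, E]^n, lists being encoded as row vectors. *)
Lemma fixed_value_maximum n : exists l, [/\ size l = n, all (in_range E) l &
  forall l', size l' = n -> all (in_range E) l' ->
    fixed_value E G l' 1 <= fixed_value E G l 1].
Proof.
pose labels (v : 'rV[R]_n) := [seq v ord0 i | i <- enum 'I_n].
pose A := [set v : 'rV[R]_n | forall i, `[1, E]%classic (v ord0 i)].
have memA v : A v <-> all (in_range E) (labels v).
  split=> [Av|/allP vr i]; last first.
    by rewrite /= in_itv; apply: vr; rewrite map_f// mem_enum.
  by apply/allP => _ /mapP[i _ ->]; have := Av i; rewrite /= in_itv.
have cA : compact A.
  by apply: (@rV_compact _ _ (fun=> `[1, E]%classic)) => i; exact: segment_compact.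
have A0 : A !=set0.
  by exists (\row_i 1) => i; rewrite /= in_itv/= mxE lexx ltW.
have cf : {within A, continuous (fun v => fixed_value E G (labels v) 1)}.
  apply: continuous_in_subspaceT => v /[1!inE] Av.
  have v0 i : v ord0 i != 0.
    have := Av i; rewrite /= in_itv/= => /andP[v1 _].
    by rewrite gt_eqF// (lt_le_trans ltr01).
  apply: (@continuous_run_payoff _ (enum 'I_n) (fun=> 1) v v0).
  exact: cst_continuous.
have [v /[1!inE] Av vmax] := EVT_max_rV A0 cA cf.
exists (labels v); split; first by rewrite size_map size_enum_ord.
  exact/memA.
move=> l ln lr; pose w : 'rV[R]_n := \row_i nth 1 l i.
have lw : labels w = l.
  apply: (@eq_from_nth _ 1); first by rewrite size_map size_enum_ord.
  move=> i; rewrite size_map size_enum_ord => ltin.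
  rewrite (nth_map (Ordinal ltin)) ?size_enum_ord// mxE.
  by rewrite nth_enum_ord.
by have := vmax w; rewrite inE lw; apply; apply/memA; rewrite lw.
Qed.

Definition unimprovable k (M : R) := forall sigma : strategy R,
  (forall h, in_range E (sigma h)) -> value E G k sigma 1 <= M.

(** Otherwise a better strategy plays [r], then [d'] if the ratio is t and [d] if it is not; by
    [run_lt] its gain at t counts. *)
Lemma unimprovable_continuation k r d d' m : all interior r ->
  all (in_range E) d -> all (in_range E) d' -> size d' = size d ->
  (size r + size d)%N = k ->
  unimprovable k (run E r (fixed_value E G d) 1) -> (m <= size r)%N ->
  forall t, t = \prod_(a <- r) a / E ^+ m ->
  fixed_value E G d' t <= fixed_value E G d t.
Proof.
move=> ri dr d'r sd <- unimp mr t tE; rewrite leNgt; apply/negP => lt_dd'.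
pose C u := if u == t then fixed d' else fixed d.
have Cr u h : in_range E (C u h) by rewrite /C; case: ifP => _; exact: fixed_range.
have rr := all_interior_in_range ri.
have := unimp _ (follow_range 1 rr Cr); rewrite value_follow leNgt => /negP; apply.
apply: (@run_lt _ _ E1 _ _ _ _ m ri) => // [u|].
  rewrite /C; case: eqP => [->|_]; last by rewrite value_fixed.
  by rewrite -sd value_fixed ltW.
by rewrite mul1r -tE /C eqxx -sd value_fixed.
Qed.

(** Take the least m with P / E^m <= G: the last division by E started above G, so it cannot end at
    or below G / E. *)
Lemma crossing (P : R) n : G / E < P -> P / E ^+ n <= G ->
  exists m, [/\ (m <= n)%N, G / E < P / E ^+ m & P / E ^+ m <= G].
Proof.
move=> GP PG; have exm : exists m, P / E ^+ m <= G by exists n.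
have := ex_minnP exm; case=> m mG mmin; exists m; split => //; first exact: mmin.
case: m mG mmin => [|m] mG mmin; first by rewrite expr0 divr1.
have : ~~ (P / E ^+ m <= G) by apply/negP => /mmin; rewrite ltnn.
rewrite -ltNge exprSr invfM mulrA => Gm.
by rewrite ltr_pM2r ?invr_gt0.
Qed.

Lemma fixed_value_noop l s : all (fun a => (a == 1) || (a == E)) l ->
  fixed_value E G l s = payoff G s.
Proof. by move=> l1; rewrite /fixed_value run_noop. Qed.

(** b = sqrt (G * E / s), and the two bounds on s put b between 1 and E. *)
Lemma best_last_label s : G / E < s -> s < G * E ->
  exists b, [/\ in_range E b, 0 < b & b ^+ 2 * s = G * E].
Proof.
move=> Gs sG; have s0 : 0 < s by rewrite (lt_trans _ Gs)// divr_gt0.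
have r0 : 0 < G * E / s by rewrite divr_gt0 ?mulr_gt0.
have b0 : 0 < Num.sqrt (G * E / s) by rewrite sqrtr_gt0.
have b2 : Num.sqrt (G * E / s) ^+ 2 = G * E / s by rewrite sqr_sqrtr ?ltW.
exists (Num.sqrt (G * E / s)); split=> //; last by rewrite b2 divfK// gt_eqF.
have r1 : 1 <= G * E / s by rewrite ler_pdivlMr// mul1r ltW.
have rE : G * E / s <= E ^+ 2.
  rewrite ler_pdivrMr// expr2 -mulrA mulrC ler_pM2l// mulrC -ler_pdivrMr// ltW//.
apply/andP; split.
  by rewrite -(ler_pXn2r (ltn0Sn 1)) ?nnegrE ?(ltW b0)// b2 expr1n.
by rewrite -(ler_pXn2r (ltn0Sn 1)) ?nnegrE ?(ltW b0) ?(ltW E0)// b2.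
Qed.

(** Labels 1 and E change nothing, so they can be played last. If there were any, one of them could
    be replaced by the optimal label at a ratio t in ]G / E, G] reached by the interior labels, a
    strict gain. *)
Lemma unimprovable_interior k l : 1 <= G -> size l = k -> all (in_range E) l ->
  0 < fixed_value E G l 1 -> unimprovable k (fixed_value E G l 1) ->
  all interior l.
Proof.
move=> G1 lk lr l_gt0 unimp.
pose r := [seq a <- l | 1 < a < E]; pose d := [seq a <- l | ~~ (1 < a < E)].
have ri : all interior r by exact: filter_all.
have dr : all (in_range E) d
  by apply/allP => a; rewrite mem_filter => /andP[_]; exact: (allP lr).
have dn : all (fun a => (a == 1) || (a == E)) d.
  apply/allP => a; rewrite mem_filter => /andP[+ /(allP lr)/andP[a1 aE]].
  rewrite negb_and -!leNgt => /orP[a1'|aE']; first by rewrite eq_le a1' a1.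
  by rewrite orbC eq_le aE aE'.
have lE : fixed_value E G l = run E r (fixed_value E G d).
  exact: (run_partition E interior l (payoff G)).
have rdk : (size r + size d)%N = k by rewrite -lk !size_filter count_predC.
case: (posnP (size d)) => [/size0nil d0|d_gt0].
  by apply/allP => a al; apply: contraT => ai;
    have : a \in d; [rewrite mem_filter ai|rewrite d0].
have rr := all_interior_in_range ri.
(* The no-ops contribute nothing, so the positive value has to come from [r] alone. *)
have rG : G < \prod_(a <- r) a.
  rewrite ltNge; apply/negP => rG; move: l_gt0; rewrite lE.
  have -> : fixed_value E G d = payoff G.
    by apply/funext => s; exact: fixed_value_noop.
  by rewrite [run _ _ _ _]fixed_value_eq0 ?mul1r ?ltxx.
have [||m [mr Gt tG]] := @crossing (\prod_(a <- r) a) (size r).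
- by rewrite (lt_trans _ rG)// ltr_pdivrMr// ltr_pMr.
- rewrite ler_pdivrMr ?exprn_gt0// (le_trans (prod_range_le rr))//.
  by rewrite ler_peMl// exprn_ge0// ltW.
pose t := \prod_(a <- r) a / E ^+ m; rewrite -/t in Gt tG.
have tGE : t < G * E by rewrite (le_lt_trans tG)// ltr_pMr.
have [b [br b0 bt]] := best_last_label Gt tGE.
(* One no-op becomes [b]; the others are normalized to 1 to keep the length. *)
pose d' := b :: nseq (size d).-1 1.
have d'r : all (in_range E) d'.
  by rewrite /= br all_nseq /in_range lexx (ltW E1) orbT.
have sd' : size d' = size d by rewrite /= size_nseq prednK.
rewrite lE in unimp.
have := unimprovable_continuation ri dr d'r sd' rdk unimp mr erefl.
rewrite -/t (fixed_value_noop t dn) leNgt => /negP[].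
rewrite -[ltRHS]/(round E b (run E (nseq (size d).-1 1) (payoff G)) t).
rewrite run_noop ?all_nseq ?eqxx ?orbT//.
(* b = 1 would mean t = G * E. Hence label 1, which earns [payoff G t], is strictly worse than
   [b]. *)
have [b1|b1] := eqVneq b 1.
  by move: bt; rewrite b1 expr1n mul1r => tE; move: tGE; rewrite tE ltxx.
have <- : round E 1 (payoff G) t = payoff G t by apply: round_noop; rewrite ?eqxx.
by apply: round_payoff_lt; rewrite // 1?eq_sym// /in_range lexx ltW.
Qed.

End optimum.

(** * Strict gain from adaptivity for 1 <= G <= E^(k-3) *)

Section strict.
Context (R : realType) (E G : R) (E1 : 1 < E) (G0 : 0 < G).
Implicit Types (a s u : R) (g : R -> R) (l r d : seq R).

Let E0 : 0 < E. Proof. by rewrite (lt_trans ltr01). Qed.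

Local Notation interior := (fun a : R => 1 < a < E).

(* Varying only the last label after the outcomes of r forces it to be the
   optimal one, sqrt (G * E / t), at each reachable likelihood ratio t. *)
Lemma unimprovable_last k r a m t : all interior r -> 1 < a < E ->
  (size r).+1 = k -> unimprovable E G k (run E r (fixed_value E G [:: a]) 1) ->
  (m <= size r)%N -> t = \prod_(b <- r) b / E ^+ m ->
  G / E < t -> t < G * E -> a ^+ 2 * t = G * E.
Proof.
move=> ri ai rk unimp mr tE Gt tG; have ar := interior_in_range ai.
have [b [br b0 bt]] := best_last_label E1 G0 Gt tG.
have [->//|ab] := eqVneq a b.
have da : all (in_range E) [:: a] by rewrite /= ar.
have db : all (in_range E) [:: b] by rewrite /= br.
have rk' : (size r + size [:: a])%N = k by rewrite addn1.
have := unimprovable_continuation E1 ri da db erefl rk' unimp mr tE.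
by rewrite leNgt [_ < _](round_payoff_lt E1 G0 Gt tG ar b0 bt ab).
Qed.

Lemma prod_nseq n a : \prod_(b <- nseq n a) b = a ^+ n.
Proof. by elim: n => [|n IH]; rewrite ?big_nil// big_cons IH exprS. Qed.

(** Play a label a last. The other labels reach some t in ]G / E, G] after n low outcomes, so a^2 *
    t = G * E; hence a^2 >= E, and a times the product of the list is G * E^(n+1). Two labels thus
    differ by a power of E, and being strictly between 1 and E they are equal. *)
Lemma unimprovable_nseq k l : 1 <= G -> (0 < k)%N -> size l = k ->
  all interior l -> 0 < fixed_value E G l 1 ->
  unimprovable E G k (fixed_value E G l 1) ->
  exists a n, [/\ l = nseq k a, (n < k)%N, a ^+ k.+1 = G * E ^+ n.+1,
    E <= a ^+ 2 & (0 < n)%N -> a ^+ 2 = E].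
Proof.
move=> G1 k0 lk li l_gt0 unimp.
have lr := all_interior_in_range li.
have PG : G < \prod_(b <- l) b.
  rewrite ltNge; apply/negP => PG; move: l_gt0.
  by rewrite fixed_value_eq0 ?mul1r ?ltxx.
have P0 : 0 < \prod_(b <- l) b by rewrite (lt_trans G0).
have split_at a : a \in l -> exists r, [/\ all interior r, (size r).+1 = k,
    \prod_(b <- l) b = a * \prod_(b <- r) b &
    unimprovable E G k (run E r (fixed_value E G [:: a]) 1)].
  move=> al; exists (rem a l); have pl := perm_to_rem al.
  split; first by apply/allP => b /mem_rem; exact: (allP li).
  - by rewrite size_rem// lk prednK.
  - by rewrite (perm_big _ pl) big_cons.
  - suff -> : run E (rem a l) (fixed_value E G [:: a]) = fixed_value E G l by [].
    rewrite [fixed_value E G [:: a]]/= run_round.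
    elim: l al {lk li l_gt0 unimp lr PG P0 pl} => //= b l IH.
    rewrite inE; case: eqVneq => [-> _ //|_ /= al].
    by rewrite -[LHS]/(round E a (round E b (run E (rem a l) (payoff G)))) roundC IH.
have label a : a \in l -> exists n, [/\ (n < k)%N,
    a * \prod_(b <- l) b = G * E ^+ n.+1, E <= a ^+ 2 &
    (0 < n)%N -> a ^+ 2 = E].
  move=> al; have [r [ri rk Pr unimp_r]] := split_at _ al.
  have ai := allP li _ al; have [a1 aE] := andP ai.
  have a0 : 0 < a by rewrite (lt_trans ltr01).
  have rr := all_interior_in_range ri.
  have [||n [nr Gt tG]] := @crossing _ E G E1 (\prod_(b <- r) b) (size r).
  - rewrite ltr_pdivrMr// (lt_le_trans PG)// Pr mulrC ler_wpM2l ?(ltW aE)//.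
    exact: prod_range_ge0 rr.
  - rewrite ler_pdivrMr ?exprn_gt0// (le_trans (prod_range_le rr))//.
    by rewrite ler_peMl// exprn_ge0// ltW.
  have En0 : E ^+ n != 0 by rewrite expf_neq0// gt_eqF.
  have tGE : \prod_(b <- r) b / E ^+ n < G * E.
    by rewrite (le_lt_trans tG)// ltr_pMr.
  have at2 := unimprovable_last ri ai rk unimp_r nr erefl Gt tGE.
  have Ea2 : E <= a ^+ 2.
    by rewrite -(ler_pM2l G0) -at2 (mulrC G) ler_pM2l ?exprn_gt0.
  exists n; split=> //; first by rewrite -rk ltnS.
  - by rewrite Pr exprS (mulrA G) -at2; field.
  (* If a^2 > E, the ratio E * t, reached with one low outcome fewer, is still below G * E, and a
     would have to be optimal at both t and E * t. *)
  move=> n0; apply/eqP/negPn/negP => a2E.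
  have {}Ea2 : E < a ^+ 2 by rewrite lt_neqAle eq_sym a2E.
  pose t := \prod_(b <- r) b / E ^+ n.-1.
  have tE : t = \prod_(b <- r) b / E ^+ n * E.
    rewrite /t -[in RHS](prednK n0) exprSr; field.
    by rewrite expf_neq0 ?gt_eqF.
  have at2' : a ^+ 2 * t = G * E * E by rewrite tE mulrA at2.
  have a20 : 0 < a ^+ 2 by rewrite exprn_gt0.
  have tlt : t < G * E.
    rewrite -(ltr_pM2l a20) at2' mulrC ltr_pM2r ?mulr_gt0//.
  have tgt : G / E < t.
    rewrite tE ltr_pdivrMr// (lt_trans _ (_ : G / E * E * E < _))//.
      by rewrite divfK ?gt_eqF// ltr_pMr.
    by rewrite !ltr_pM2r.
  have nr' : (n.-1 <= size r)%N by rewrite (leq_trans (leq_pred n)).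
  have := unimprovable_last ri ai rk unimp_r nr' erefl tgt tlt.
  rewrite -/t at2' -[RHS]mulr1 => /(mulfI (lt0r_neq0 (mulr_gt0 G0 E0))) E1'.
  by move: E1; rewrite E1' ltxx.
have [a al] : exists a, a \in l.
  by exists (nth 1 l 0); rewrite mem_nth// lk.
have [n [nk aP aE an]] := label a al.
have allE : all (pred1 a) l.
  apply/allP => b bl; have [n' [_ bP _ _]] := label b bl.
  have [a1 aE'] := andP (allP li _ al).
  have [b1 bE] := andP (allP li _ bl).
  suff nn' : n' = n.
    by apply/eqP/(mulIf (lt0r_neq0 P0)); rewrite bP aP nn'.
  (* c P = G E^(i+1) and c' P = G E^(j+1) with j > i would give c' >= E * c > E. *)
  have far (c c' : R) i j : 1 < c -> c' < E ->
      c * \prod_(b <- l) b = G * E ^+ i.+1 ->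
      c' * \prod_(b <- l) b = G * E ^+ j.+1 -> (j <= i)%N.
    move=> c1 c'E cP c'P; rewrite leqNgt; apply/negP => ij.
    have : G * E ^+ j.+1 < G * E ^+ i.+2.
      rewrite [E ^+ i.+2]exprSr mulrA -cP -c'P mulrAC ltr_pM2r// (lt_trans c'E)//.
      by rewrite ltr_pMl.
    by rewrite ltr_pM2l// ltr_eXn2l// !ltnS leqNgt ij.
  by apply/eqP; rewrite eqn_leq (far _ _ _ _ a1 bE aP bP) (far _ _ _ _ b1 aE' bP aP).
exists a, n; have lE := all_pred1P _ _ allE; rewrite lk in lE.
by split=> //; rewrite -aP lE prod_nseq exprS.
Qed.

(** If nothing beat [l], then [l] would repeat one label, and at some reachable ratio its remaining
    part would be worthless although another list still earns something there. *)
Lemma adaptivity_gain k l : (4 <= k)%N -> 1 <= G -> G <= E ^+ (k - 3) ->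
  size l = k -> all (in_range E) l ->
  exists2 sigma, (forall h, in_range E (sigma h)) &
    fixed_value E G l 1 < value E G k sigma 1.
Proof.
move=> k4 G1 GE lk lr; apply: contrapT => nogain.
have unimp : unimprovable E G k (fixed_value E G l 1).
  by move=> sigma sr; rewrite leNgt; apply/negP => lt; apply: nogain; exists sigma.
have k0 : (0 < k)%N by rewrite (leq_trans _ k4).
have l_gt0 : 0 < fixed_value E G l 1.
  have [|l1 [l1k l1r l1_gt0]] := @fixed_value_gt0 _ E G E1 k 1 ltr01.
    by rewrite mul1r (le_lt_trans GE)// ltr_eXn2l// ltn_subrL.
  have := unimp _ (fixed_range E1 l1r).
  by rewrite -l1k value_fixed; exact: lt_le_trans.
have li := unimprovable_interior E1 G0 G1 lk lr l_gt0 unimp.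
have [a [n [lE nk ak aE an]]] := unimprovable_nseq G1 k0 lk li l_gt0 unimp.
have ai : 1 < a < E.
  by apply: (allP li); rewrite lE mem_nseq k0 eqxx.
have [a1 aE'] := andP ai; have a0 : 0 < a by rewrite (lt_trans ltr01).
(* With j rounds left after m low outcomes, the remaining labels cannot lift the ratio above G,
   while labels near E can. *)
suff [j [m [jk mj tG Gt]]] : exists j m, [/\ (j <= k)%N, (m <= k - j)%N,
    a ^+ (k - j) / E ^+ m * a ^+ j <= G & G < a ^+ (k - j) / E ^+ m * E ^+ j].
  have ri : all interior (nseq (k - j) a) by rewrite all_nseq ai orbT.
  have dr : all (in_range E) (nseq j a).
    by rewrite all_nseq interior_in_range ?orbT.
  pose t := \prod_(b <- nseq (k - j) a) b / E ^+ m.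
  have t0 : 0 < t by rewrite /t prod_nseq divr_gt0 ?exprn_gt0.
  have [d' [d'j d'r]] : exists l', [/\ size l' = j, all (in_range E) l' &
      0 < fixed_value E G l' t].
    by apply: fixed_value_gt0 => //; rewrite /t prod_nseq.
  have sd' : size d' = size (nseq j a) by rewrite size_nseq.
  have rk : (size (nseq (k - j) a) + size (nseq j a))%N = k.
    by rewrite !size_nseq subnK.
  have mj' : (m <= size (nseq (k - j) a))%N by rewrite size_nseq.
  have unimp' : unimprovable E G k
      (run E (nseq (k - j) a) (fixed_value E G (nseq j a)) 1).
    by rewrite /fixed_value -run_cat -nseqD subnK// -lE.
  have := unimprovable_continuation E1 ri dr d'r sd' rk unimp' mj' erefl.
  rewrite -/t (fixed_value_eq0 E1 dr (ltW t0)); last by rewrite /t !prod_nseq.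
  by rewrite leNgt => /negP.
have ak' : a ^+ k = G * E ^+ n.+1 / a by rewrite -ak exprSr mulfK ?gt_eqF.
have En0 : 0 < E ^+ n.+1 by rewrite exprn_gt0.
have [n0|n0] := posnP n.
(* n = 0: after one low outcome the ratio is a / E. The list ends at most at a^k / E = G / a, while
   the reachable bound a * E^(k-2) exceeds E^(k-3) >= G. *)
- exists k.-1, 1%N; rewrite leq_pred -subn1 subKn//; split=> //.
  + rewrite !expr1 mulrAC -exprS subn1 prednK// ak' n0 expr1.
    rewrite [G * E / a]mulrAC mulfK ?gt_eqF// ler_pdivrMr// ler_peMr ?ltW//.
  + have -> : a ^+ 1 / E ^+ 1 * E ^+ (k - 1) = a * E ^+ (k - 2).
      rewrite !expr1 (_ : k - 1 = (k - 2).+1)%N; last by clear -k4; lia.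
      by rewrite exprS mulrA divfK ?gt_eqF.
    apply: (le_lt_trans GE); apply: (@le_lt_trans _ _ (E ^+ (k - 2))).
      by rewrite ler_eXn2l//; clear -k4; lia.
    by rewrite ltr_pMl ?exprn_gt0.
- have aE2 := an n0.
  (* G >= 1 and a^2 = E give E^(2n+2) <= a^(2k+2) = E^(k+1). With k >= 4 this yields n + 1 <= k - 2,
     so n + 1 low outcomes fit before the last two rounds. There the list reaches at most G / a,
     against the reachable bound G * a. *)
  have nk2 : (n.+1 + n.+1 <= k.+1)%N.
    rewrite -(ler_eXn2l E1) exprD -[leRHS](_ : a ^+ k.+1 * a ^+ k.+1 = _).
      by rewrite ak mulrACA ler_peMl ?mulr_ge0 ?(ltW En0)// mulr_ege1.
    by rewrite -exprMn -expr2 aE2.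
  have kE : k = (k - 2).+2 by clear -k4; lia.
  exists 2, n.+1; split; [clear -k4; lia|clear -k4 nk2; lia| |].
  + rewrite mulrAC -exprD addn2 -kE ak' mulrAC mulfK ?gt_eqF//.
    by rewrite ler_pdivrMr// ler_peMr ?ltW.
  + have -> : a ^+ (k - 2) / E ^+ n.+1 * E ^+ 2 = G * a.
      have aE4 : a ^+ (k - 2) * E ^+ 2 = G * a * E ^+ n.+1.
        rewrite mulrAC -ak -exprSr kE -aE2 -exprM -exprD; congr (a ^+ _).
        by clear -k4; lia.
      by rewrite mulrAC aE4 mulfK ?gt_eqF.
    by rewrite ltr_pMr.
Qed.

End strict.

(** * Bounds on the optimal delta of one mechanism *)

Section delta_opt_bounds.
Context (R : realType) (U : universe) (M : mechanism R U) (eps_g : R).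

Lemma delta_opt_le (N : R) : dp M eps_g N -> (delta_opt M eps_g <= N%:E)%E.
Proof. by move=> dpN; apply: ereal_inf_lbound; exists N. Qed.

Lemma le_delta_opt (v : R) x x' S : neighbor x x' -> measurable S ->
  (v%:E + (expR eps_g)%:E * law M x' S <= law M x S)%E ->
  (v%:E <= delta_opt M eps_g)%E.
Proof.
move=> xx' mS vS; apply: le_ereal_inf_tmp => _ [delta dpd <-].
have := le_trans vS (dpd _ _ xx' _ mS); rewrite addeC leeD2lE//.
by rewrite fin_numM// fin_num_measure.
Qed.

End delta_opt_bounds.

(** * Biased coins as extremal bounded-range mechanisms *)

Section coins.
Context (R : realType) (E : R) (E1 : 1 < E).
Implicit Types a : R.

Let E0 : 0 < E. Proof. by rewrite (lt_trans ltr01). Qed.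

(** [b = true] is the numerator law: the denominator law reweighted by the ratio [a] on outcome
    true, and by a / E on outcome false. *)
Definition coin_prob a (b : bool) : R :=
  if b then a * hi_prob E a else hi_prob E a.

Definition coin_law a (b : bool) : probability bool R :=
  bernoulli_prob (coin_prob a b).

Lemma coin_probC a : in_range E a ->
  1 - a * hi_prob E a = a / E * (1 - hi_prob E a).
Proof.
move=> /andP[a1 _]; rewrite hi_probC// /hi_prob.
by field; move: E1 a1; lra.
Qed.

Lemma coin_prob01 a b : in_range E a -> 0 <= coin_prob a b <= 1.
Proof.
move=> ar; have /andP[q0 q1] := hi_prob01 E1 ar.
have a0 : 0 <= a by case/andP: ar => a1 _; rewrite (le_trans ler01).
case: b; rewrite /coin_prob ?q0 ?q1//.
rewrite mulr_ge0//= -subr_ge0 coin_probC//.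
by rewrite mulr_ge0 ?divr_ge0 ?subr_ge0// ltW.
Qed.

Lemma integral_coin_law a b (f : bool -> \bar R) : in_range E a ->
  (forall y, 0 <= f y)%E ->
  (\int[coin_law a b]_y f y =
    (coin_prob a b)%:E * f true + (1 - coin_prob a b)%:E * f false)%E.
Proof. by move=> ar f0; rewrite integral_bernoulli_prob// coin_prob01. Qed.

(** The reverse of [bounded_range_step]: a coin takes only the two extreme ratios, so the bounds at
    its two outcomes add up with the weights of the round. *)
Lemma coin_step (G s a u v : R) (f f' : bool -> \bar R) :
  in_range E a -> 0 <= G -> 0 <= s ->
  (forall y, 0 <= f y)%E -> (forall y, 0 <= f' y)%E ->
  (u%:E + G%:E * f' true <= (s * a)%:E * f true)%E ->
  (v%:E + G%:E * f' false <= (s * a / E)%:E * f false)%E ->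
  ((hi_prob E a * u + (1 - hi_prob E a) * v)%:E + G%:E * \int[coin_law a false]_y f' y
    <= s%:E * \int[coin_law a true]_y f y)%E.
Proof.
move=> ar G0 s0 f0 f'0 hi lo; rewrite !integral_coin_law//.
have /andP[q0] := hi_prob01 E1 ar; rewrite -subr_ge0 => q1.
have a0 : 0 <= a by case/andP: ar => a1 _; rewrite (le_trans ler01).
have aE0 : 0 <= a / E by rewrite divr_ge0// ltW.
rewrite /coin_prob coin_probC//; set q := hi_prob E a in q0 q1 *.
have -> : (s%:E * ((a * q)%:E * f true + (a / E * (1 - q))%:E * f false) =
    q%:E * ((s * a)%:E * f true) + (1 - q)%:E * ((s * a / E)%:E * f false))%E.
  have aq0 : 0 <= a * q by exact: mulr_ge0.
  have aEq0 : 0 <= a / E * (1 - q) by exact: mulr_ge0.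
  rewrite ge0_muleDr ?mule_ge0 ?lee_fin// !muleA -!EFinM.
  by congr (_%:E * _ + _%:E * _)%E; ring.
have -> : ((q * u + (1 - q) * v)%:E +
      G%:E * (q%:E * f' true + (1 - q)%:E * f' false) =
    q%:E * (u%:E + G%:E * f' true) +
    (1 - q)%:E * (v%:E + G%:E * f' false))%E.
  rewrite ge0_muleDr ?mule_ge0 ?lee_fin// !muleDr// ?fin_num_adde_defr//.
  by rewrite EFinD !EFinM addeACA !(muleCA _ G%:E).
by apply: leeD; apply: lee_wpmul2l; rewrite ?lee_fin.
Qed.

Definition coin_mechanism a : mechanism R bit_universe :=
  Mechanism (coin_law a : dataset bit_universe -> probability bool R).

End coins.

Lemma bounded_range_coin (R : realType) (eps a : R) : 0 < eps ->
  in_range (expR eps) a -> bounded_range eps (coin_mechanism (expR eps) a).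
Proof.
move=> eps0 ar; have E1 : 1 < expR eps by rewrite expR_gt1.
set E := expR eps in ar E1 *.
pose p (b y : bool) : R := bernoulli_pmf (coin_prob E a b) y.
have p0 b y : 0 <= p b y by apply: bernoulli_pmf_ge0; exact: coin_prob01.
have half01 : 0 <= (2^-1 : R) <= 1 by lra.
(* The reference measure is the fair coin, so densities are twice the mass functions. *)
exists (bernoulli_prob 2^-1), (fun b y => 2 * p b y); split.
- by [].
- by move=> b y; rewrite mulr_ge0.
- move=> b S mS; rewrite integral_mkcond integral_bernoulli_prob//; last first.
    by move=> y; rewrite patchE; case: ifP; rewrite ?lee_fin ?mulr_ge0.
  rewrite [LHS]bernoulli_probE ?coin_prob01//.
  rewrite !diracE !patchE /p /bernoulli_pmf /unstable.onem.
  by case: (true \in S); case: (false \in S);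
    rewrite ?mule0 ?mule1 -?EFinM -?EFinD; congr EFin; field.
- move=> b b' bb' y1 y2.
  have E0 : 0 < E by rewrite expR_gt0.
  set q := hi_prob E a; have /andP[q0] := hi_prob01 E1 ar.
  rewrite -subr_ge0 -/q => q1.
  have a0 : 0 <= a by case/andP: ar => a1 _; rewrite (le_trans ler01).
  have EE (c : R) : 0 <= c -> c <= E * c by move=> c0; rewrite ler_peMl// ltW.
  have diag y : 2 * p b y * (2 * p b' y) <= E * (2 * p b y * (2 * p b' y)).
    by apply: EE; rewrite !mulr_ge0.
  have pC : bernoulli_pmf (a * q) false = a / E * (1 - q).
    by rewrite -coin_probC.
  set w := a / E * (1 - q) in pC.
  (* The ratios at the two outcomes differ by exactly the factor E. *)
  have wE : E * (w * q) = a * q * (1 - q) by rewrite /w; field; rewrite gt_eqF.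
  have wle : w * q <= E * (a * q * (1 - q)).
    have c0 : 0 <= a * q * (1 - q) by apply: mulr_ge0 => //; exact: mulr_ge0.
    apply: le_trans (EE _ c0); rewrite -wE; apply: EE.
    by apply: mulr_ge0 => //; apply: mulr_ge0 => //; exact: divr_ge0 (ltW E0).
  case: y1 y2 => [] []; rewrite ?diag//; case: b b' bb' {diag} => [] [] // _;
    rewrite /p /coin_prob -/q ?pC /bernoulli_pmf -/E; move: wE wle; lra.
Qed.

(** * Upper and lower bounds for nonadaptive composition *)

Section nonadaptive.
Context (R : realType) (eps : R) (eps0 : 0 < eps) (G : R) (G0 : 0 <= G).
Local Notation E := (expR eps).
Local Notation composition n M :=
  (\big[@mechanism_prod R _/mechanism_unit R _]_(i < n) M i).

Let E1 : 1 < E. Proof. by rewrite expR_gt1. Qed.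

(** The list is chosen before [S] and [s], so the induction hypothesis applies to the section of [S]
    at every first outcome and at every ratio with the same labels. *)
Lemma nonadaptive_le U n (M : 'I_n -> mechanism R U) x x' :
  (forall i, bounded_range eps (M i)) -> neighbor x x' ->
  exists l, [/\ size l = n, all (in_range E) l & forall S s, measurable S -> 0 <= s ->
    (s%:E * law (composition n M) x S
      <= G%:E * law (composition n M) x' S + (fixed_value E G l s)%:E)%E].
Proof.
move=> + xx'; elim: n M => [|n IH] M brM.
  exists [::]; split => //; rewrite big_ord0 => S s mS s0 /=.
  rewrite !diracE; case: (_ \in _); rewrite ?mule1 ?mule0 -?EFinD lee_fin.
    by rewrite -lerBlDl le_max lexx.
  by rewrite add0r payoff_ge0.
rewrite big_ord_recl; have [l [ln lr]] := IH _ (fun i => brM (lift ord0 i)).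
set N := \big[_/_]_(i < n) _ => lN.
have [a ar step] := bounded_range_step eps0 (brM ord0) xx'.
exists (a :: l); split => /=; first by rewrite ln.
  by rewrite lr andbT.
move=> S s mS s0; have := step G s (fixed_value E G l)
  (fun y => law N x (xsection S y)) (fun y => law N x' (xsection S y)).
apply=> //.
- by move=> u _; exact: fixed_value_ge0.
- exact: below_chords_fixed_value.
- exact: measurable_fun_xsection.
- exact: measurable_fun_xsection.
- by move=> y u /andP[u0 _]; apply: lN => //; exact: measurable_xsection.
Qed.

(** Coins with these labels attain the bound; the event is assembled from one section per outcome of
    the first coin. *)
Lemma nonadaptive_coins_ge l s : all (in_range E) l -> 0 <= s ->
  let M (i : 'I_(size l)) := coin_mechanism E (nth 1 l i) in
  exists2 S, measurable S &
    ((fixed_value E G l s)%:E + G%:E * law (composition (size l) M) false S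
      <= s%:E * law (composition (size l) M) true S)%E.
Proof.
elim: l s => [|a l IH] s /=.
  (* Neyman-Pearson test: accept exactly when the final ratio exceeds G. *)
  move=> _ s0; rewrite big_ord0; have [sG|Gs] := leP s G.
    by exists set0 => //; rewrite /fixed_value/= payoff_eq0// !measure0 !mule0 adde0.
  exists setT => //; rewrite !probability_setT !mule1 /fixed_value/=.
  by rewrite (payoffE (ltW Gs)) -EFinD subrK.
move=> /andP[ar lr] s0; rewrite big_ord_recl /=.
set N := \big[_/_]_(i < size l) _.
have a0 : 0 <= a by case/andP: ar => a1 _; rewrite (le_trans ler01).
have [S1 mS1 S1E] := IH (s * a) lr (mulr_ge0 s0 a0).
have [S2 mS2 S2E] := IH (s * a / E) lr (divr_ge0 (mulr_ge0 s0 a0) (expR_ge0 _)).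
pose S := [set z | if z.1 then S1 z.2 else S2 z.2].
have xS y : xsection S y = if y then S1 else S2.
  by rewrite xsectionE; case: y.
exists S.
  have -> : S = [set true] `*` S1 `|` [set false] `*` S2.
    apply/seteqP; split=> [[[] r] /= Sr|[y r] /= [[-> //]|[-> //]]]; by [left|right].
  by apply: measurableU; exact: measurableX.
have := coin_step (u := fixed_value E G l (s * a))
  (v := fixed_value E G l (s * a / E)) (f := fun y => law N true (xsection S y))
  (f' := fun y => law N false (xsection S y)) E1 ar G0 s0.
by rewrite !xS; apply.
Qed.

End nonadaptive.

(** * Integration over one round of the game *)

Section view_integral.
Context (R : realType) (C : nat -> mechanism_class R) (A : adversary C).
Local Open Scope ereal_scope.
Local Notation history := (history (out_space A) (coin_space A)).

Definition average_coin i (f : history i.+1 -> \bar R) :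
    history i * out_space A i -> \bar R :=
  fun z => \int[coin A i z]_c f (z, c).

Definition average_round i (b : bool) (f : history i.+1 -> \bar R) :
    history i -> \bar R :=
  fun h => \int[sel_law (sel_data (select h) b)]_y average_coin f (h, y).

Lemma average_coin_ge0 i (f : history i.+1 -> \bar R) z :
  (forall h, 0 <= f h) -> 0 <= average_coin f z.
Proof. by move=> f0; exact: integral_ge0. Qed.

Lemma average_round_ge0 i b (f : history i.+1 -> \bar R) h :
  (forall h, 0 <= f h) -> 0 <= average_round b f h.
Proof. by move=> f0; apply: integral_ge0 => y _; exact: average_coin_ge0. Qed.

Lemma measurable_average_coin i (f : history i.+1 -> \bar R) :
  (forall h, 0 <= f h) -> measurable_fun [set: history i.+1] f ->
  measurable_fun [set: history i * out_space A i] (average_coin f).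
Proof.
move=> f0 mf.
exact: (measurable_fun_integral_finite_kernel f (coin A i) f0 mf).
Qed.

Lemma measurable_average_round i b (f : history i.+1 -> \bar R) :
  (forall h, 0 <= f h) -> measurable_fun [set: history i.+1] f ->
  measurable_fun [set: history i] (average_round b f).
Proof.
move=> f0 mf.
have g0 z : 0 <= average_coin f z by exact: average_coin_ge0.
exact: (measurable_fun_integral_finite_kernel (average_coin f)
  (kprobability (select_measurable (a := A) (i := i) b)) g0
  (measurable_average_coin f0 mf)).
Qed.

Lemma ge0_integral_view i b (f : history i.+1 -> \bar R) :
  (forall h, 0 <= f h) -> measurable_fun [set: history i.+1] f ->
  \int[view A b i.+1]_h f h = \int[view A b i]_h average_round b f h.
Proof.
move=> f0 mf.
transitivity (\int[semidirect (view A b i)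
    (kprobability (select_measurable (a := A) (i := i) b))]_z average_coin f z).
  exact: ge0_integral_semidirect.
apply: ge0_integral_semidirect; first by move=> z; exact: average_coin_ge0.
exact: measurable_average_coin.
Qed.

End view_integral.

(** * Upper bound for the game when G >= E^(k-1) *)

Section adaptive_upper.
Context (R : realType) (eps : R) (eps0 : 0 < eps) (G : R) (G0 : 0 <= G).
Local Notation E := (expR eps).

Let E1 : 1 < E. Proof. by rewrite expR_gt1. Qed.
Let E0 : 0 < E. Proof. by rewrite expR_gt0. Qed.

(** For the adversary's own coins, whose law is the same under both bits: averaging over them leaves
    the likelihood ratio unchanged. *)
Lemma average_le d (T : measurableType d) (P : {measure set T -> \bar R})
    (P1 : P setT = 1%E) (f f' : T -> \bar R) (u v : R) : 0 <= u -> 0 <= v ->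
  (forall y, 0 <= f y)%E -> (forall y, 0 <= f' y)%E ->
  measurable_fun [set: T] f -> measurable_fun [set: T] f' ->
  (forall y, u%:E * f y <= G%:E * f' y + v%:E)%E ->
  (u%:E * \int[P]_y f y <= G%:E * \int[P]_y f' y + v%:E)%E.
Proof.
move=> u0 v0 f0 f'0 mf mf' dom.
have -> : v%:E = (\int[P]_y (cst v%:E y))%E.
  by rewrite integral_cst// P1 mule1.
rewrite -!ge0_integralZl// -ge0_integralD//; first last.
- exact: measurable_funeM.
- by move=> y _; rewrite mule_ge0.
apply: ge0_le_integral => //.
- by move=> y _; rewrite mule_ge0.
- exact: measurable_funeM.
- by apply: emeasurable_funD => //; exact: measurable_funeM.
Qed.

(* A decision with acceptance probabilities f h under one law and f' h under
   the other, given the history h, is dominated by V at time i; averaging over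
   one more round moves the domination from time i + 1 to time i, so only the
   densities of the individual rounds are ever needed. *)
Lemma view_le (k : nat) (V : nat -> R -> R)
    (V0 : forall i u, 0 <= u -> 0 <= V i u)
    (cV : forall i, below_chords (V i))
    (roundV : forall i a s, (i < k)%N -> in_range E a -> 0 <= s <= E ^+ i ->
      round E a (V i.+1) s <= V i s)
    (A : adversary (fun=> bounded_range eps)) (b : bool) i
    (f f' : history (out_space A) (coin_space A) i -> \bar R) :
  (i <= k)%N -> (forall h, 0 <= f h)%E -> (forall h, 0 <= f' h)%E ->
  measurable_fun setT f -> measurable_fun setT f' ->
  (forall h u, 0 <= u <= E ^+ i ->
    (u%:E * f h <= G%:E * f' h + (V i u)%:E)%E) ->
  (\int[view A b i]_h f h
    <= G%:E * \int[view A (~~ b) i]_h f' h + (V 0 1)%:E)%E.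
Proof.
elim: i f f' => [|i IH] f f' ik f0 f'0 mf mf' dom.
  rewrite -[leLHS]mul1e; apply: average_le => //; [exact: probability_setT|exact: V0|].
  by move=> h; apply: dom; rewrite ler01 expr0 lexx.
rewrite !ge0_integral_view//; apply: IH; first exact: ltnW.
- by move=> h; exact: average_round_ge0.
- by move=> h; exact: average_round_ge0.
- exact: measurable_average_round.
- exact: measurable_average_round.
move=> h s /andP[s0 sE].
have nb : neighbor (sel_data (select h) b) (sel_data (select h) (~~ b)).
  by case: b; [apply: neighbor_sym|]; exact: sel_neighbor.
(* Here the label depends on the history [h]; this is harmless because [roundV] holds for every
   label in range. *)
have [a ar step] := bounded_range_step eps0 (sel_class (select h)) nb.
have mc (g : history (out_space A) (coin_space A) i.+1 -> \bar R) :
    (forall h, 0 <= g h)%E -> measurable_fun setT g ->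
    measurable_fun setT (fun y => average_coin g (h, y)).
  move=> g0 mg; apply: (measurableT_comp (measurable_average_coin g0 mg)).
  exact: measurable_pair1.
apply: le_trans (step G s (V i.+1) _ _ G0 s0 _ _ _ _ (mc _ f0 mf) (mc _ f'0 mf') _) _.
- exact: V0.
- exact: cV.
- by move=> y; exact: average_coin_ge0.
- by move=> y; exact: average_coin_ge0.
- move=> y u /andP[u0 us].
  have avg := @average_le _ _ (coin A i (h, y)) (prob_kernel (h, y))
    (fun c => f (h, y, c)) (fun c => f' (h, y, c)) u (V i.+1 u) u0 (V0 _ _ u0).
  apply: avg => //.
  + exact: (measurableT_comp mf (measurable_pair1 _)).
  + exact: (measurableT_comp mf' (measurable_pair1 _)).
  + by move=> c; apply: dom; rewrite u0 (le_trans us)// exprSr ler_pM2r.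
- by rewrite leeD2l// lee_fin roundV// s0.
Qed.

Definition fixed_values (j : nat) (u : R) : set R :=
  [set fixed_value E G l u | l in [set l | size l = j /\ all (in_range E) l]].

(** The supremum is taken separately at each ratio [u], as the best list may change with [u]. *)
Definition best_fixed_value j u : R := sup (fixed_values j u).

Lemma has_sup_fixed_values j u : 0 <= u -> has_sup (fixed_values j u).
Proof.
move=> u0; split; last first.
  by exists u => _ [l [_ lr] <-]; exact: fixed_value_le_id.
exists (fixed_value E G (nseq j 1) u), (nseq j 1) => //=.
by rewrite size_nseq all_nseq /in_range lexx (ltW E1) orbT.
Qed.

Lemma le_best_fixed_value l u : 0 <= u -> all (in_range E) l ->
  fixed_value E G l u <= best_fixed_value (size l) u.
Proof.
move=> u0 lr; apply: sup_upper_bound; first exact: has_sup_fixed_values.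
by exists l.
Qed.

Lemma best_fixed_value_le j u v : 0 <= u ->
  (forall l, size l = j -> all (in_range E) l -> fixed_value E G l u <= v) ->
  best_fixed_value j u <= v.
Proof.
move=> u0 lev; apply: sup_le_ub; first by case: (has_sup_fixed_values j u0).
by move=> _ [l [lj lr] <-]; exact: lev.
Qed.

Lemma best_fixed_value_ge0 j u : 0 <= u -> 0 <= best_fixed_value j u.
Proof.
move=> u0; have nr : all (in_range E) (nseq j 1).
  by rewrite all_nseq /in_range lexx (ltW E1) orbT.
apply: le_trans (fixed_value_ge0 G E1 u nr) _.
by rewrite -[X in best_fixed_value X _](size_nseq j (1 : R)) le_best_fixed_value.
Qed.

(** A supremum of convex functions is convex; x = z is set apart because the argument divides by z -
    x. *)
Lemma below_chords_best_fixed_value j : below_chords (best_fixed_value j).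
Proof.
move=> x y z x0 xy yz; have y0 := le_trans x0 xy; have z0 := le_trans y0 yz.
have [zx|xz] := eqVneq z x.
  have yx : y = x by apply/le_anti; rewrite xy -zx yz.
  by rewrite zx yx subrr !mul0r addr0.
have xz0 : 0 < z - x by rewrite subr_gt0 lt_neqAle eq_sym xz (le_trans xy).
rewrite mulrC -ler_pdivlMr//; apply: best_fixed_value_le => // l lj lr.
rewrite ler_pdivlMr// mulrC.
apply: le_trans (below_chords_fixed_value G E1 lr x0 xy yz) _.
by rewrite lerD// ler_wpM2l ?subr_ge0// -lj le_best_fixed_value.
Qed.

(* When G >= E ^ (k - 1), one unlikely outcome makes the final likelihood ratio
   at most G, so only the path of likely outcomes contributes. *)
Lemma round_best_fixed_value k i a s : E ^+ k.-1 <= G -> (i < k)%N ->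
  in_range E a -> 0 <= s <= E ^+ i ->
  round E a (best_fixed_value (k - i.+1)) s <= best_fixed_value (k - i) s.
Proof.
move=> EG ik ar /andP[s0 sE].
have [a1 aE] := andP ar; have a0 : 0 <= a by rewrite (le_trans ler01).
have sa0 : 0 <= s * a by rewrite mulr_ge0.
have saE0 : 0 <= s * a / E by rewrite divr_ge0 ?(ltW E0).
have saE : s * a / E <= E ^+ i.
  rewrite (le_trans _ sE)// ler_pdivrMr// ler_wpM2l//.
have low : best_fixed_value (k - i.+1) (s * a / E) = 0.
  apply/le_anti; rewrite best_fixed_value_ge0// andbT.
  apply: best_fixed_value_le => // l lj lr.
  rewrite fixed_value_eq0//; apply: le_trans EG.
  have -> : k.-1 = (i + size l)%N by rewrite lj; clear -ik; lia.
  rewrite exprD ler_pM//; first exact: prod_range_ge0 lr.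
  exact: prod_range_le.
have /andP[q0 q1] := hi_prob01 E1 ar.
rewrite /round low mulr0 addr0; move: q0; rewrite le_eqVlt => /predU1P[<-|q0].
  by rewrite mul0r best_fixed_value_ge0.
(* Only the high branch is left, so each list [l] after the label [a] can be compared with the
   single list a :: l. *)
rewrite mulrC -ler_pdivlMr//; apply: best_fixed_value_le => // l lj lr.
rewrite ler_pdivlMr// mulrC.
have alr : all (in_range E) (a :: l) by rewrite /= ar.
have -> : (k - i)%N = size (a :: l) by rewrite /= lj; clear -ik; lia.
apply: le_trans (le_best_fixed_value s0 alr).
by rewrite -[leRHS]/(round E a (fixed_value E G l) s) lerDl mulr_ge0 ?subr_ge0
  ?fixed_value_ge0.
Qed.

Lemma adaptive_le k (A : adversary (fun=> bounded_range eps)) b S :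
  E ^+ k.-1 <= G -> measurable S ->
  (view A b k S <= G%:E * view A (~~ b) k S + (best_fixed_value k 1)%:E)%E.
Proof.
move=> EG mS.
pose f h : \bar R := (\1_S h)%:E.
have f0 h : (0 <= f h)%E by rewrite lee_fin.
have mf : measurable_fun setT f by apply/measurable_EFinP; exact: measurable_indic.
have viewE c : (view A c k S = \int[view A c k]_h f h)%E.
  by rewrite integral_indic// setIT.
rewrite !viewE -[k in best_fixed_value k]subn0.
apply: (@view_le k (fun i => best_fixed_value (k - i))) => //.
- by move=> i u; exact: best_fixed_value_ge0.
- by move=> i; exact: below_chords_best_fixed_value.
- by move=> i a s; exact: round_best_fixed_value.
move=> h u /andP[u0 _]; rewrite subnn.
have := @le_best_fixed_value [::] u u0 isT; rewrite /fixed_value/= => pu.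
rewrite /f indicE; case: (_ \in _); rewrite ?mule1 ?mule0 -?EFinD lee_fin.
  by rewrite -lerBlDl (le_trans _ pu)// le_max lexx.
by rewrite add0r best_fixed_value_ge0.
Qed.

End adaptive_upper.

(** * Strategies realized by adversaries that select coins *)

Section discrete_product.
Context d1 d2 (X : measurableType d1) (Y : measurableType d2).

(** As Y is finite, [A] is a finite union of rectangles, one for each y. *)
Lemma measurable_all_prod : finite_set [set: Y] ->
  (forall A : set X, measurable A) -> (forall A : set Y, measurable A) ->
  forall A : set (X * Y), measurable A.
Proof.
move=> fY mX mY A.
have -> : A = \bigcup_(y in [set: Y]) (ysection A y `*` [set y]).
  apply/seteqP; split=> [[x y] Axy|[x z] [y _ [/= + ->]]].
    by exists y => //; split => //=; rewrite ysectionE.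
  by rewrite ysectionE.
by apply: fin_bigcup_measurable => // y _; exact: measurableX.
Qed.

End discrete_product.

Section coin_adversary.
Context (R : realType) (eps : R) (eps0 : 0 < eps) (sigma : strategy R).
Local Notation E := (expR eps).
Context (sigma_range : forall h, in_range E (sigma h)).

Let E1 : 1 < E. Proof. by rewrite expR_gt1. Qed.

Definition bools (i : nat) : measurableType _ := bool.
Definition units (i : nat) : measurableType _ := unit.

Local Notation history := (history bools units).

Fixpoint transcript i : history i -> seq bool :=
  match i return history i -> seq bool with
  | 0 => fun=> [::]
  | j.+1 => fun h => rcons (transcript h.1.1) h.1.2
  end.

Fixpoint ratio i : history i -> R :=
  match i return history i -> R with
  | 0 => fun=> 1
  | j.+1 => fun h =>
      let a := sigma (transcript h.1.1) in
      if h.1.2 then ratio h.1.1 * a else ratio h.1.1 * a / E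
  end.

Lemma ratio_ge0 i (h : history i) : 0 <= ratio h.
Proof.
elim: i h => //= i IH [[h y] c] /=.
have a0 : 0 <= sigma (transcript h).
  by case/andP: (sigma_range (transcript h)) => a1 _; rewrite (le_trans ler01).
by case: y; rewrite ?divr_ge0 ?mulr_ge0 ?expR_ge0.
Qed.

Lemma measurable_history i (S : set (history i)) : measurable S.
Proof.
elim: i S => [//|i IH] S.
have mHB : forall T : set (history i * bools i), measurable T.
  by apply: measurable_all_prod => //; exact: finite_finset.
have mU : forall T : set (units i.+1), measurable T by [].
have fU : finite_set [set: units i.+1] by exact: finite_finset.
exact (@measurable_all_prod _ _ (history i * bools i)%type (units i.+1) fU mHB mU S).
Qed.

Lemma measurable_fun_history i d (T : measurableType d) (f : history i -> T) :
  measurable_fun setT f.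
Proof. by move=> _ B _; exact: measurable_history. Qed.

Definition coin_selection a (ar : in_range E a) :
    selection (@bounded_range R eps) (bools 0) :=
  @Selection R (@bounded_range R eps) _ (bools 0) bit_universe id isT
    (coin_law E a) (bounded_range_coin eps0 ar).

(** The adversary's own randomness is trivial, so histories form a finite space on which every
    selection is measurable. *)
Definition coin_adversary : adversary (fun=> @bounded_range R eps) :=
  @Adversary R (fun=> @bounded_range R eps) _ _ bools units
    (\d_tt : probability unit R)
    (fun i => kdirac (measurable_cst tt))
    (fun i h => coin_selection (sigma_range (transcript h)))
    (fun i b => @measurable_fun_history i _ _ _).

Local Notation A := coin_adversary.

Lemma ge0_integral_unit (mu : probability unit R) (f : unit -> \bar R) :
  (\int[mu]_c f c = f tt)%E.
Proof.
rewrite (eq_integral (cst (f tt))); last by move=> [].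
by rewrite integral_cst// -[RHS]mule1; congr (_ * _)%E; exact: probability_setT.
Qed.

(** Of the i + n rounds, i are integrated and n are summarized by [value]; the induction moves the
    last integrated round into [value] by [coin_step]. *)
Lemma view_coin_ge (G : R) n i
    (f f' : Defs.history (out_space A) (coin_space A) i -> \bar R) : 0 <= G ->
  (forall h, 0 <= f h)%E -> (forall h, 0 <= f' h)%E ->
  (forall h, (value E G n (fun w => sigma (transcript h ++ w)) (ratio h))%:E +
    G%:E * f' h <= (ratio h)%:E * f h)%E ->
  ((value E G (i + n) sigma 1)%:E + G%:E * \int[view A false i]_h f' h
    <= \int[view A true i]_h f h)%E.
Proof.
move=> G0; elim: i n f f' => [|i IH] n f f' f0 f'0 dom.
  have := dom tt; rewrite !ge0_integral_unit mul1e; exact.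
have mf (g : Defs.history (out_space A) (coin_space A) i.+1 -> \bar R) :
  measurable_fun setT g by exact: measurable_fun_history.
rewrite !ge0_integral_view// addSnnS; apply: IH.
- by move=> h; exact: average_round_ge0.
- by move=> h; exact: average_round_ge0.
move=> h /=.
have coinE b (g : Defs.history (out_space A) (coin_space A) i.+1 -> \bar R) :
    average_round b g h =
    (\int[coin_law E (sigma (transcript h)) b]_y g (h, y, tt))%E.
  apply: eq_integral => y _; rewrite /average_coin /= integral_dirac//.
  by rewrite diracT mul1e.
rewrite !coinE.
rewrite cats0; apply: coin_step => //; first exact: ratio_ge0.
- have -> : (fun w => sigma (transcript h ++ true :: w)) =
      (fun w => sigma (rcons (transcript h) true ++ w)).
    by apply/funext => w; rewrite cat_rcons.
  exact: (dom (h, true, tt)).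
- have -> : (fun w => sigma (transcript h ++ false :: w)) =
      (fun w => sigma (rcons (transcript h) false ++ w)).
    by apply/funext => w; rewrite cat_rcons.
  exact: (dom (h, false, tt)).
Qed.

End coin_adversary.

(** * Optimal deltas of both classes through lists and strategies *)

Section delta_opt_classes.
Context (R : realType) (eps : R) (eps0 : 0 < eps) (eps_g : R) (k : nat).
Local Notation E := (expR eps).
Local Notation G := (expR eps_g).

Let E1 : 1 < E. Proof. by rewrite expR_gt1. Qed.
Let G0 : 0 < G. Proof. exact: expR_gt0. Qed.

Lemma nonadaptive_delta_le (N : R) :
  (forall l, size l = k -> all (in_range E) l -> fixed_value E G l 1 <= N) ->
  (delta_opt_class (nonadaptive_br eps k) eps_g <= N%:E)%E.
Proof.
move=> maxN; apply: ge_ereal_sup => _ [U [M [brM ->]]].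
case: brM => {}U {}M _ brM; apply: delta_opt_le => x x' xx' S mS.
have [l [lk lr]] := nonadaptive_le eps0 (ltW G0) brM xx'.
move/(_ S 1 mS ler01); rewrite mul1e => /le_trans; apply.
by rewrite leeD2l// lee_fin maxN.
Qed.

Lemma nonadaptive_delta_ge l : size l = k -> all (in_range E) l ->
  ((fixed_value E G l 1)%:E <= delta_opt_class (nonadaptive_br eps k) eps_g)%E.
Proof.
move=> lk lr; have := nonadaptive_coins_ge eps0 (ltW G0) lr ler01.
rewrite lk => -[S mS]; rewrite mul1e => SE.
have brM (i : 'I_k) : bounded_range eps (coin_mechanism E (nth 1 l i)).
  by apply: bounded_range_coin => //; apply: (all_nthP _ lr); rewrite lk.
have nb : neighbor (u := bit_universe) true false by [].
apply: le_trans (le_delta_opt nb mS SE) _.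
apply: ereal_sup_ubound; exists bit_universe; eexists; split => //.
by constructor => //; exists true, false.
Qed.

Lemma adaptive_delta_ge sigma : (forall h, in_range E (sigma h)) ->
  ((value E G k sigma 1)%:E <= delta_opt_class (adaptive_br eps k) eps_g)%E.
Proof.
move=> sr; pose A := coin_adversary eps0 sr.
(* The Neyman-Pearson test again: on [S] the payoff is ratio - G, off [S] it is 0. *)
pose S : set (history (out_space A) (coin_space A) k) :=
  [set h | G < ratio eps sigma h].
have mS : measurable S by exact: measurable_history.
apply: (@le_trans _ _ (delta_opt (adacomp A k) eps_g)); last first.
  by apply: ereal_sup_ubound; exists bit_universe, (adacomp A k); split.
apply: (@le_delta_opt _ _ (adacomp A k) _ _ true false S) => //=.
have viewE b : (view A b k S = \int[view A b k]_h (\1_S h)%:E)%E.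
  by rewrite integral_indic// setIT.
rewrite !viewE -[k in value _ _ k]addn0.
apply: view_coin_ge; first exact: ltW.
- by move=> h; rewrite lee_fin.
- by move=> h; rewrite lee_fin.
move=> h /=; rewrite indicE; have [hS|hS] := boolP (h \in S).
  rewrite !mule1 -EFinD lee_fin payoffE ?subrK//.
  by move: hS; rewrite inE => /ltW.
rewrite !mule0 adde0 lee_fin payoff_eq0// leNgt; apply/negP => Gh.
by move: hS; rewrite notin_setE; apply.
Qed.

Lemma adaptive_delta_le (N : R) : E ^+ k.-1 <= G ->
  (forall l, size l = k -> all (in_range E) l -> fixed_value E G l 1 <= N) ->
  (delta_opt_class (adaptive_br eps k) eps_g <= N%:E)%E.
Proof.
move=> EG maxN; apply: ge_ereal_sup => _ [U [M [brM ->]]].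
case: brM => A; apply: delta_opt_le => b b' bb' S mS.
have -> : b' = ~~ b by case: b b' bb' => [] [].
apply: le_trans (adaptive_le eps0 (ltW G0) b EG mS) _.
by rewrite leeD2l// lee_fin; apply: best_fixed_value_le => //; exact: ltW.
Qed.

End delta_opt_classes.

Theorem theorem4 (R : realType) (eps : R) (k : nat)
    (eps_gt0 : 0 < eps) (k_ge1 : (1 <= k)%N) :
  ((4 <= k)%N -> forall eps_g : R, 0 <= eps_g <= (k%:R - 3) * eps ->
    (delta_opt_class (nonadaptive_br eps k) eps_g
      < delta_opt_class (adaptive_br eps k) eps_g)%E) /\
  (forall eps_g : R, (k%:R - 1) * eps <= eps_g ->
    delta_opt_class (adaptive_br eps k) eps_g
      = delta_opt_class (nonadaptive_br eps k) eps_g).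
Proof.
have E1 : 1 < expR eps by rewrite expR_gt1.
split=> [k4|] eps_g.
  move=> /andP[eps_g0 eps_gk]; have G0 := expR_gt0 eps_g.
  (* The maximum over lists is attained, so a strategy that beats this one list separates the two
     suprema strictly. *)
  have [l [lk lr lmax]] := fixed_value_maximum (expR eps_g) E1 k.
  have G1 : 1 <= expR eps_g by rewrite -expR0 ler_expR.
  have GE : expR eps_g <= expR eps ^+ (k - 3).
    by rewrite -expRM_natl ler_expR natrB// ltnW.
  have [sigma sr gain] := adaptivity_gain E1 G0 k4 G1 GE lk lr.
  apply: le_lt_trans (nonadaptive_delta_le eps_gt0 lmax) _.
  by apply: lt_le_trans (adaptive_delta_ge eps_gt0 eps_g k sr); rewrite lte_fin.
move=> eps_gk.
have [l [lk lr lmax]] := fixed_value_maximum (expR eps_g) E1 k.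
have EG : expR eps ^+ k.-1 <= expR eps_g.
  by rewrite -expRM_natl ler_expR -subn1 natrB.
apply/le_anti/andP; split.
  apply: le_trans (adaptive_delta_le eps_gt0 EG lmax) _.
  exact: nonadaptive_delta_ge.
apply: le_trans (nonadaptive_delta_le eps_gt0 lmax) _.
(* A fixed list is itself a strategy. *)
rewrite -value_fixed lk; apply: adaptive_delta_ge => //; exact: fixed_range.
Qed.
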